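(* Let $\eta_t(\omega)$ be the random walk in random environment built from $\delta\in(0,1/2)$, $\alpha>0$ and the i.i.d. vectors $(\xi_i,Y_i)$ as described in the context. Suppose $\mathbb{E}[\zeta_1]=0$, $s^2\in(0,\infty)$, $\lambda\neq 0$ and $\sigma^2\in[0,\infty)$. (i) Suppose $\alpha>1/2$. Then, for $\mathbb{P}$-a.e. $\omega$, for any $\varepsilon>0$, we have $P$-a.s. that $$0\le \frac{\eta_t(\omega)}{(\log t)^2} < (\log\log t)^{2+\varepsilon}$$ for all but finitely many $t$. (ii) Suppose $\alpha=1/2$. Then, for $\mathbb{P}$-a.e. $\omega$, for any $\varepsilon>0$, we have $P$-a.s. that $$0\le \frac{\eta_t(\omega)}{(\log t)^2} < (\log\log t)^{4+\varepsilon}$$ for all but finitely many $t$. (iii) On the other hand, for $\alpha\ge 1/2$, for $\mathbb{P}$-a.e. $\omega$, for any $\varepsilon>0$, we have $P$-a.s. that $$\frac{\eta_t(\omega)}{(\log t)^2} > (\log\log\log t)^{-1-\varepsilon}$$ for infinitely many $t$.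
   Context: Environment. Fix $\delta\in(0,1/2)$ and $\alpha>0$. Let $(\xi_i,Y_i)$, $i\in\mathbb{N}=\{1,2,\dots\}$, be i.i.d. random vectors on a probability space $(\Omega,\mathcal{F},\mathbb{P})$ (with expectation $\mathbb{E}$ and variance $\mathrm{Var}$) such that $\mathbb{P}[\delta\le\xi_1\le 1-\delta]=1$ and $Y_1$ takes values in $[-1,1]$; $\xi_1$ and $Y_1$ may be dependent. Set $p_0=q_0=1/2$ and, for $n\ge1$, let $p_n$ be the truncation of $\xi_n+Y_nn^{-\alpha}$ to $[\delta/2,1-\delta/2]$, i.e. $p_n=\xi_n+Y_nn^{-\alpha}$ if this lies in $[\delta/2,1-\delta/2]$, $p_n=\delta/2$ if $\xi_n+Y_nn^{-\alpha}<\delta/2$, and $p_n=1-\delta/2$ if $\xi_n+Y_nn^{-\alpha}>1-\delta/2$; let $q_n=1-p_n$. The environment is $\omega=(p_0,p_1,p_2,\dots)$. Walk. Given $\omega$, $(\eta_t(\omega);t\in\mathbb{Z}^+)$, $\mathbb{Z}^+=\{0,1,2,\dots\}$, is the Markov chain on $\mathbb{Z}^+$ under the quenched probability $P$ (depending on $\omega$), with $\eta_0(\omega)=r$ for some fixed $r\in\mathbb{Z}^+$ and transition probabilities: from $n\ge1$, to $n-1$ with probability $p_n$ and to $n+1$ with probability $q_n$; from $0$, to $0$ with probability $p_0$ and to $1$ with probability $q_0$. Notation. $\zeta_n=\log\left(\frac{\xi_n}{1-\xi_n}\right)$, $Z_n=\frac{Y_n}{\xi_n(1-\xi_n)}$,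 $\lambda=\mathbb{E}[Z_1]$, $s^2=\mathrm{Var}[\xi_1]$, $\sigma^2=\mathrm{Var}[Y_1]$. *)

(* Defs.v *)
From mathcomp Require Import all_boot all_order all_algebra.
From mathcomp Require Import all_classical all_reals all_analysis.

Set Implicit Arguments.
Unset Strict Implicit.
Unset Printing Implicit Defensive.

Import Order.TTheory GRing.Theory Num.Theory.
Import numFieldNormedType.Exports.

Local Open Scope classical_set_scope.
Local Open Scope ring_scope.

Section probability_notions.
Context {d : measure_display} {T : measurableType d} {R : realType}.
Variable P : probability T R.

Definition mutually_independent {d' : measure_display}
    {T' : measurableType d'} (D : set nat) (X : nat -> {RV P >-> T'}) : Prop :=
  forall (s : seq nat) (A : nat -> set T'),
    uniq s -> [set` s] `<=` D -> (forall i, measurable (A i)) ->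
    P (\bigcap_(i in [set` s]) X i @^-1` A i)
      = (\prod_(i <- s) P (X i @^-1` A i))%E.

Definition identically_distributed {d' : measure_display}
    {T' : measurableType d'} (D : set nat) (X : nat -> {RV P >-> T'}) : Prop :=
  forall i j, D i -> D j -> forall A : set T', measurable A ->
    distribution P (X i) A = distribution P (X j) A.

Definition iid {d' : measure_display} {T' : measurableType d'}
    (D : set nat) (X : nat -> {RV P >-> T'}) : Prop :=
  mutually_independent D X /\ identically_distributed D X.

(* Only meaningful when [P B != 0]. *)
Definition cond_prob (A B : set T) : R := fine (P (A `&` B)) / fine (P B).

End probability_notions.

Section environment.
Context {R : realType}.

Definition truncate (a b x : R) : R :=
  if x < a then a else if b < x then b else x.

(* [envp delta alpha x y n] is p_n when xi_n = x n and Y_n = y n; the values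
   x 0 and y 0 are not used. *)
Definition envp (delta alpha : R) (x y : nat -> R) (n : nat) : R :=
  if n == 0%N then 2^-1
  else truncate (delta / 2) (1 - delta / 2) (x n + y n * n%:R `^ (- alpha)).

Definition trans (p : nat -> R) (i j : nat) : R :=
  match i with
  | 0 => if j == 0%N then p 0%N else if j == 1%N then 1 - p 0%N else 0
  | n.+1 => if j == n then p n.+1 else if j == n.+2 then 1 - p n.+1 else 0
  end.

Definition quenched_walk {d : measure_display} {W : measurableType d}
    (Q : probability W R) (p : nat -> R) (r : nat)
    (eta : nat -> {RV Q >-> nat}) : Prop :=
  Q [set x | eta 0%N x = r] = 1%E /\
  forall (t : nat) (i : nat -> nat) (j : nat),
    let past := [set x | forall s, (s <= t)%N -> eta s x = i s] in
    Q past != 0%E ->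
    cond_prob Q [set x | eta t.+1 x = j] past = trans p (i t) j.

End environment.

(* Main.v *)
Require Import Defs.
From mathcomp Require Import all_boot all_order all_algebra.
From mathcomp Require Import all_classical all_reals all_analysis.
From mathcomp Require Import measurable_realfun.
From mathcomp Require Import zify ring lra.

Set Implicit Arguments.
Unset Strict Implicit.
Unset Printing Implicit Defensive.

Import Order.TTheory GRing.Theory Num.Theory.
Import numFieldNormedType.Exports.

Local Open Scope classical_set_scope.
Local Open Scope ring_scope.

(* Write V n for the sum of ln (p_i / (1 - p_i)) over 1 <= i <= n. For a walk on the
   half-line the one-step equations solve explicitly in terms of exp V, which
   gives two bounds on the time T_b needed to reach b: if V rises by h between
   some a >= r and b, then P(T_b <= t) <= t exp(-h); if |V| <= M up to b, then
   E T_b <= C b^2 exp(2 M).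

   For alpha >= 1/2 the perturbation changes an increment of V over
   [a, a + n] by at most C n / sqrt a, so V can be compared with the random walk
   S with centred bounded steps zeta_i, whatever the sign of lambda.
   - Upper bounds: among k disjoint blocks of length 4^k located beyond k 4^k,
     the probability that S rises by less than c 2^k over each block is at most
     (1 - p0)^k by a fourth-moment argument; by Borel-Cantelli such a rise of V
     exists for every large k, and eta_t < 3 k 4^k for t <= exp(c 2^k / 4).
     Hence eta_t = O((log t)^2 log log t), so that (i) and (ii) both hold.
   - Lower bound: by Kolmogorov's maximal inequality max_{k <= n} |S_k| <= K sqrt n
     for infinitely many n, for some random K; for these n the walk
     reaches n before time exp(K' sqrt n) with probability close to 1, so that
     limsup eta_t / (log t)^2 > 0. *)

(** * The walk in a fixed environment *)

Section markov_property.
Context {d : measure_display} {W : measurableType d} {R : realType}.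
Variables (Q : probability W R) (p : nat -> R) (r : nat).
Variable eta : nat -> {RV Q >-> nat}.
Hypothesis walk : quenched_walk p r eta.

Lemma measurable_path (t : nat) (C : nat -> set nat) :
  measurable [set x | forall s, (s <= t)%N -> C s (eta s x)].
Proof.
rewrite [X in measurable X](_ : _ =
  \bigcap_(s in [set s | (s <= t)%N]) (eta s @^-1` C s)); last first.
  by apply/seteqP; split=> x /=.
by apply: bigcap_measurable; [exists 0%N | move=> s _; exact: measurable_funPTI].
Qed.

Lemma measurable_step (t : nat) (j : nat) : measurable [set x | eta t x = j].
Proof. exact: (measurable_funPTI (eta t) (Y := [set j])). Qed.

(** Multiplied out, the Markov property also covers pasts of probability zero, since the smaller
    event is then null too. This form can be summed over pasts without case distinctions. *)
Lemma markov_cylinder (t : nat) (i : nat -> nat) (j : nat) :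
  Q ([set x | forall s, (s <= t)%N -> eta s x = i s] `&` [set x | eta t.+1 x = j])
  = (Q [set x | forall s, (s <= t)%N -> eta s x = i s] * (trans p (i t) j)%:E)%E.
Proof.
have [_ /(_ t i j)] := walk.
set past := [set x | _] => /= trE.
have mpast : measurable past by exact: (measurable_path t (fun s => [set i s])).
have mj := measurable_step t.+1 j.
have [Q0|/[dup] Q0 /trE{trE}] := eqVneq (Q past) 0%E.
  rewrite Q0 mul0e; apply/eqP; rewrite eq_le measure_ge0 andbT -Q0.
  by rewrite le_measure ?inE//; exact: measurableI.
rewrite /cond_prob setIC => <-.
have fQ : Q past \is a fin_num by exact: fin_num_measure.
rewrite -[in LHS](@fineK _ (Q _)); last by apply: fin_num_measure; exact: measurableI.
rewrite -[in X in _ = (X * _)%E](fineK fQ) -EFinM mulrC divfK//.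
by rewrite fine_eq0.
Qed.

(** By induction on [u], the time before which the path is confined to regions rather than
    prescribed: the value at time [u] splits the event into countably many disjoint events with one
    more prescribed position. *)
Lemma markov_partial (t u : nat) (C : nat -> set nat) (i : nat -> nat) (j : nat) :
  (u <= t)%N ->
  let B := [set x | forall s, (s <= t)%N ->
              if (s < u)%N then C s (eta s x) else eta s x = i s] in
  Q (B `&` [set x | eta t.+1 x = j]) = (Q B * (trans p (i t) j)%:E)%E.
Proof.
elim: u i => [|u IH] i ut /=; first exact: markov_cylinder.
set B := (X in Q (X `&` _)).
pose iv v := fun s => if s == u then v else i s.
pose Bv v := [set x | forall s, (s <= t)%N ->
    if (s < u)%N then C s (eta s x) else eta s x = iv v s].
have mBv v : measurable (Bv v).
  have := measurable_path t (fun s => if (s < u)%N then C s else [set iv v s]).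
  congr measurable; apply/seteqP; split=> x /= H s /H; by case: ifP.
have BE : B = \bigcup_(v in C u) Bv v.
  apply/seteqP; split=> [x Bx|x [v Cv Bvx] s st].
    have := Bx u (ltnW ut); rewrite ltnSn => Cu; exists (eta u x) => // s st.
    have := Bx s st; rewrite /iv; have [->|su] := eqVneq s u; first by rewrite ltnn.
    by rewrite ltnS (leq_eqVlt s u) (negbTE su).
  have := Bvx s st; rewrite /iv; have [->|su] := eqVneq s u.
    by rewrite ltnn ltnSn => ->.
  by rewrite ltnS (leq_eqVlt s u) (negbTE su).
have tB : trivIset (C u) Bv.
  move=> v w _ _ [x [/(_ u (ltnW ut)) + /(_ u (ltnW ut))]].
  by rewrite ltnn /iv eqxx => -> ->.
have mj := measurable_step t.+1 j.
rewrite -/B BE setI_bigcupl measure_bigcup; last 2 first.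
- by move=> v _; exact: measurableI.
- exact: trivIset_setIr.
rewrite measure_bigcup// muleC -nneseriesZl//; apply: eq_eseriesr => v _.
have := IH (iv v) (ltnW ut); rewrite /= -/(Bv v) => ->.
(* Since [u < t], the split leaves the last position [i t] unchanged, so all terms share the same
   transition factor. *)
by rewrite muleC {1}/iv; have [tu|//] := eqVneq t u; rewrite tu ltnn in ut.
Qed.

(* Mass function of the walk killed on leaving [0, b): killing makes every sum finite. *)
Definition killed (b t x : nat) : R :=
  fine (Q [set w | forall s, (s <= t)%N ->
    if (s < t)%N then is_true (eta s w < b)%N else eta s w = x]).

Definition stays_below (b t : nat) : set W :=
  [set w | forall s, (s <= t)%N -> (eta s w < b)%N].

Lemma measurable_killed_set (b t x : nat) :
  measurable [set w | forall s, (s <= t)%N ->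
    if (s < t)%N then is_true (eta s w < b)%N else eta s w = x].
Proof.
have := measurable_path t (fun s => if (s < t)%N then [set y | (y < b)%N] else [set x]).
by congr measurable; apply/seteqP; split=> w /= H s /H; case: ifP.
Qed.

Lemma measurable_stays_below b t : measurable (stays_below b t).
Proof. exact: (measurable_path t (fun=> [set y | (y < b)%N])). Qed.

Lemma killed_ge0 b t x : 0 <= killed b t x.
Proof. by rewrite fine_ge0. Qed.

Lemma killed0 b x : killed b 0 x = (x == r)%:R.
Proof.
have [Q0 _] := walk; rewrite /killed.
rewrite [X in Q X](_ : _ = [set w | eta 0%N w = x]); last first.
  apply/seteqP; split=> w /= H; first exact: (H 0%N).
  by move=> s; rewrite leqn0 => /eqP ->.
have [->|xr] := eqVneq x r; first by rewrite Q0.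
suff -> : Q [set w | eta 0%N w = x] = 0%E by [].
apply/eqP; rewrite eq_le measure_ge0 andbT.
rewrite (_ : 0 = Q (~` [set w | eta 0%N w = r]))%E; last first.
  by rewrite probability_setC ?Q0 ?subee//; exact: measurable_step.
rewrite le_measure ?inE//; first exact: measurable_step.
- exact/measurableC/measurable_step.
- by move=> w /= wx wr; move: xr; rewrite -wx -wr eqxx.
Qed.

Lemma sum_killed b t : \sum_(x < b) killed b t x = fine (Q (stays_below b t)).
Proof.
pose F x := [set w | forall s, (s <= t)%N ->
    if (s < t)%N then is_true (eta s w < b)%N else eta s w = x].
have mF x : measurable (F x) by exact: measurable_killed_set.
have -> : stays_below b t = \big[setU/set0]_(x < b) F x.
  rewrite -bigcup_mkord; apply/seteqP; split=> [w Bw|w [x /= xb Fw] s st].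
    exists (eta t w); first exact: Bw.
    move=> s st; case: ltnP => [_|ts]; first exact: Bw.
    by have -> : s = t by apply/eqP; rewrite eqn_leq st.
  by have := Fw s st; case: ltnP => // _ ->.
rewrite measure_bigsetU//.
  by rewrite -sum_fine// => x _; exact: fin_num_measure.
by move=> x y _ _ [w [/(_ t (leqnn t)) + /(_ t (leqnn t))]]; rewrite ltnn => -> ->.
Qed.

Lemma killedS b t x :
  killed b t.+1 x = \sum_(y < b) killed b t y * trans p y x.
Proof.
pose F y := [set w | forall s, (s <= t)%N ->
    if (s < t)%N then is_true (eta s w < b)%N else eta s w = y].
have mF y : measurable (F y) by exact: measurable_killed_set.
have mx := measurable_step t.+1 x.
pose G y := F y `&` [set w | eta t.+1 w = x].
have mG y : measurable (G y) by exact: measurableI.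
rewrite /killed.
rewrite [X in Q X](_ : _ = \big[setU/set0]_(y < b) G y).
  rewrite measure_bigsetU//; last first.
    apply: trivIset_setIr => y z _ _ [w [/(_ t (leqnn t)) + /(_ t (leqnn t))]].
    by rewrite ltnn => -> ->.
  rewrite -sum_fine; last by move=> y _; exact: fin_num_measure.
  apply: eq_bigr => y _.
  have := markov_partial (fun=> [set z | (z < b)%N]) (fun=> (y : nat)) x (leqnn t).
  by rewrite /= -/(F y) -/(G y) => ->; rewrite fineM// fin_num_measure.
rewrite -bigcup_mkord; apply/seteqP; split=> [w Bw|w [y /= yb [Fw wx]] s].
  exists (eta t w); first by have := Bw t (leqnSn t); rewrite ltnSn.
  split; last by have := Bw t.+1 (leqnn _); rewrite ltnn.
  move=> s st; have := Bw s (leqW st); rewrite ltnS st.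
  case: (ltnP s t) => [_ //|ts _].
  by have -> : s = t by apply/eqP; rewrite eqn_leq st.
rewrite leq_eqVlt => /predU1P[->|]; first by rewrite ltnn.
rewrite ltnS => st; rewrite st; have := Fw s st.
by case: (ltnP s t) => // _ ->.
Qed.

End markov_property.

(** * The potential and the one-step equations *)

Section potential.
Context {R : realType}.
Variable p : nat -> R.

(** The potential of the environment: it rises where the drift points towards 0, so a high rise is a
    barrier. *)
Definition potential (n : nat) : R := \sum_(1 <= i < n.+1) ln (p i / (1 - p i)).

Lemma potential0 : potential 0 = 0.
Proof. by rewrite /potential big_geq. Qed.

Lemma potentialS n : potential n.+1 = potential n + ln (p n.+1 / (1 - p n.+1)).
Proof. by rewrite /potential big_nat_recr. Qed.

(** With [f b = 0] the index [k = b] is harmless, so a sum over [x < b] applies the full transition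
    kernel even at [b - 1], from where the walk may step to [b]. *)
Lemma sum_delta (b k : nat) (c : R) (f : nat -> R) : (k <= b)%N -> f b = 0 ->
  \sum_(x < b) (if x == k :> nat then c else 0) * f x = c * f k.
Proof.
rewrite leq_eqVlt => /predU1P[-> ->|kb fb].
  by rewrite mulr0 big1// => x _; rewrite ltn_eqF// mul0r.
rewrite (bigD1 (Ordinal kb))//= eqxx big1 ?addr0// => x xk.
by rewrite (_ : (x == k :> nat) = false) ?mul0r//; exact: (negbTE xk).
Qed.

Lemma sum_trans0 (b : nat) (f : nat -> R) : (0 < b)%N -> f b = 0 ->
  \sum_(x < b) trans p 0 x * f x = p 0%N * f 0%N + (1 - p 0%N) * f 1%N.
Proof.
move=> b0 fb; rewrite -(@sum_delta b 0)// -(@sum_delta b 1)// -big_split.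
by apply: eq_bigr => -[[|[|x]] ?] _ //=; rewrite ?mul0r ?addr0 ?add0r.
Qed.

Lemma sum_transS (b n : nat) (f : nat -> R) : (n.+1 < b)%N -> f b = 0 ->
  \sum_(x < b) trans p n.+1 x * f x = p n.+1 * f n + (1 - p n.+1) * f n.+2.
Proof.
move=> nb fb; rewrite -(@sum_delta b n)//; last by rewrite ltnW// ltnW.
rewrite -(@sum_delta b n.+2)// -big_split.
apply: eq_bigr => x _ /=; have [->|_] := eqVneq (x : nat) n.
  by rewrite (_ : (n == n.+2) = false) ?mul0r ?addr0//; lia.
by rewrite mul0r add0r.
Qed.

Hypothesis p01 : forall n, 0 < p n < 1.

(** This balance makes the function with increments [expR (V k)] harmonic at [n.+1]; it also yields
    the recursion for the expected crossing times. *)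
Lemma expR_potentialS n :
  (1 - p n.+1) * expR (potential n.+1) = p n.+1 * expR (potential n).
Proof.
have /andP[p0 p1] := p01 n.+1.
rewrite potentialS expRD lnK ?posrE ?divr_gt0 ?subr_gt0//.
by field; rewrite subr_eq0 gt_eqF.
Qed.

End potential.

(** * Two bounds on hitting times *)

Section walk_estimates.
Context {d : measure_display} {W : measurableType d} {R : realType}.
Variables (Q : probability W R) (p : nat -> R) (r : nat).
Variable eta : nat -> {RV Q >-> nat}.
Hypothesis walk : quenched_walk p r eta.
Hypothesis p01 : forall n, 0 < p n < 1.
Local Notation V := (potential p).

Lemma killed_recursion (b t : nat) (f : nat -> R) :
  \sum_(x < b) killed eta b t.+1 x * f x =
  \sum_(y < b) killed eta b t y * \sum_(x < b) trans p y x * f x.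
Proof.
under eq_bigr do rewrite (killedS walk) mulr_suml.
rewrite exchange_big; apply: eq_bigr => y _; rewrite mulr_sumr.
by apply: eq_bigr => x _; rewrite mulrA.
Qed.

Lemma killed_recursion0 (b : nat) (f : nat -> R) : (r < b)%N ->
  \sum_(x < b) killed eta b 0 x * f x = f r.
Proof.
move=> rb; rewrite (bigD1 (Ordinal rb))//= big1 => [|x xr].
  by rewrite (killed0 walk) eqxx mul1r addr0.
rewrite (killed0 walk) (_ : (x == r :> nat) = false) ?mul0r//.
by apply/negbTE; apply: contra xr => /eqP xr; apply/eqP/val_inj.
Qed.

Lemma sum_killed_le1 (b t : nat) : \sum_(x < b) killed eta b t x <= 1.
Proof.
rewrite sum_killed -lee_fin fineK ?fin_num_measure//; last exact: measurable_stays_below.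
by apply: probability_le1; exact: measurable_stays_below.
Qed.

(** The function [g] below is harmonic on [[0, b)] except at [a], where one step loses at most [e]:
    from there the whole rise must be climbed before returning. The total mass is at most 1, so [t]
    steps lose at most [t * e]. *)
Lemma stays_below_ge (a b t : nat) : (0 < a)%N -> (a < b)%N -> (r <= a)%N ->
  1 - t%:R * expR (- (V b.-1 - V a)) <= fine (Q (stays_below eta b t)).
Proof.
move=> a0 ab ra.
(* [1 - g x] is the probability of reaching [b] before [a] from [x]. *)
pose s x := \sum_(a <= k < x) expR (V k).
pose g x := if (x <= b)%N then 1 - s x / s b else 0.
have sS x : (a <= x)%N -> s x.+1 = s x + expR (V x).
  by move=> ax; rewrite /s big_nat_recr.
have s0 x : (x <= a)%N -> s x = 0 by move=> xa; rewrite /s big_geq.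
have sb0 : expR (V b.-1) <= s b.
  have bE : b = b.-1.+1 by rewrite (ltn_predK ab).
  have ab1 : (a <= b.-1)%N by rewrite -ltnS -bE.
  by rewrite [in s b]bE sS// lerDr sumr_ge0// => k _; exact: expR_ge0.
have sb1 : 0 < s b by apply: lt_le_trans sb0; exact: expR_gt0.
have gb : g b = 0 by rewrite /g leqnn divff ?subrr// gt_eqF.
have g1 x : (x <= a)%N -> g x = 1.
  by move=> xa; rewrite /g (leq_trans xa (ltnW ab)) s0// mul0r subr0.
have gle1 x : g x <= 1.
  rewrite /g; case: ifP => // _; rewrite gerBl divr_ge0//; last exact: ltW.
  by apply: sumr_ge0 => k _; exact: expR_ge0.
set e := expR _.
have step y : (y < b)%N -> g y - e <= \sum_(x < b) trans p y x * g x.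
  case: y => [_|n nb].
    rewrite (sum_trans0 p (ltn_trans a0 ab) gb) !g1//.
    by rewrite !mulr1 subrKC gerBl expR_ge0.
  rewrite sum_transS//.
  have /andP[p0 p1] := p01 n.+1.
  have [na|] := ltnP n.+1 a.
    by rewrite !g1 ?(ltnW (ltnW na))// ?(ltnW na)// !mulr1 subrKC gerBl expR_ge0.
  rewrite leq_eqVlt => /predU1P[na|an].
    (* Only the term [expR (V a)] separates [g a.+1] from 1; it is compared with the last term of
       [s b]. *)
    have gS : 1 - e <= g a.+1.
      rewrite /g ab sS// s0// add0r lerD2l lerN2 ler_pdivrMr//.
      apply: le_trans (ler_wpM2l (expR_ge0 _) sb0).
      by rewrite -expRD opprB subrK.
    have e0 : 0 <= e by exact: expR_ge0.
    rewrite -na in p0 p1 *; rewrite (g1 a)// (g1 n) ?na//.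
    have h1 : 0 <= (1 - p a) * (g a.+1 - (1 - e)).
      by rewrite mulr_ge0// subr_ge0// ltW.
    have h2 : 0 <= p a * e by rewrite mulr_ge0// ltW.
    by rewrite na in h1 h2 *; lra.
  have nb' : (n.+2 <= b)%N by [].
  rewrite /g (ltnW nb) nb' (ltnW (ltnW nb)).
  (* Strictly between [a] and [b], the balance relation makes [s], hence [g], harmonic. *)
  have := expR_potentialS p01 n.
  rewrite (sS n.+1) ?(ltnW an)// (sS n) ?ltnS// => h.
  suff -> : 1 - (s n + expR (V n)) / s b = p n.+1 * (1 - s n / s b) +
      (1 - p n.+1) * (1 - (s n + expR (V n) + expR (V n.+1)) / s b).
    by rewrite gerBl expR_ge0.
  have sbn0 : s b != 0 by rewrite gt_eqF.
  apply: (mulIf sbn0).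
  have dK y : y / s b * s b = y by rewrite divfK.
  have dK' c y : c * (1 - y / s b) * s b = c * (s b - y) by rewrite -mulrA mulrBl mul1r dK.
  rewrite mulrBl mul1r dK [in RHS]mulrDl !dK'.
  by move: h; lra.
have main : 1 - t%:R * e <= \sum_(x < b) killed eta b t x * g x.
  elim: t => [|t IH].
    by rewrite mul0r subr0 killed_recursion0 ?g1//; exact: leq_ltn_trans ab.
  rewrite killed_recursion.
  apply: (@le_trans _ _ (\sum_(y < b) killed eta b t y * (g y - e))).
    under eq_bigr do rewrite mulrBr.
    rewrite sumrB -mulr_suml.
    have := sum_killed_le1 b t; set m := \sum_(_ < _) _ => m1.
    have : m * e <= 1 * e by apply: ler_wpM2r => //; exact: expR_ge0.
    by move: IH; rewrite -natr1; lra.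
  by apply: ler_sum => y _; apply: ler_wpM2l; [exact: killed_ge0 | exact: step].
apply: le_trans main _; rewrite -sum_killed; apply: ler_sum => x _.
by rewrite ler_piMr// killed_ge0.
Qed.


(** Each step lowers the mean of the remaining time [w] by the survival probability, which decreases
    in time. Hence [T] times its value at [T] is at most [w r], a double sum of at most [b ^ 2]
    terms [expR (V x - V i) / (1 - p i)]. *)
Lemma stays_below_le (b T : nat) (M del : R) : (r < b)%N -> 0 < del ->
  (forall n, del <= 1 - p n) ->
  (forall n, (n < b)%N -> `|V n| <= M) ->
  T%:R * fine (Q (stays_below eta b T)) <= b%:R ^+ 2 * del^-1 * expR (2 * M).
Proof.
move=> rb del0 pdel VM.
(* [D x] and [w x] are the expected times to reach [x.+1] and [b] from [x]. *)
pose D x := \sum_(0 <= i < x.+1) expR (V x - V i) / (1 - p i).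
pose w x := \sum_(x <= k < b) D k.
have D0 : D 0%N * (1 - p 0%N) = 1.
  rewrite /D big_nat1 subrr expR0 divfK// gt_eqF// subr_gt0.
  by case/andP: (p01 0).
(* First-step analysis: a step down costs one crossing [D n] before a new attempt at [D n.+1]. *)
have DS n : (1 - p n.+1) * D n.+1 = 1 + p n.+1 * D n.
  have q0 : 1 - p n.+1 != 0 by rewrite gt_eqF// subr_gt0; case/andP: (p01 n.+1).
  rewrite /D big_nat_recr//= subrr expR0 mulrDr addrC mulrCA mulfV// mulr1; congr (_ + _).
  rewrite !mulr_sumr; apply: eq_bigr => i _.
  by rewrite !expRD !mulrA expR_potentialS.
have wb : w b = 0 by rewrite /w big_geq.
have wS x : (x < b)%N -> w x = D x + w x.+1 by move=> xb; rewrite /w big_ltn.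
have step y : (y < b)%N -> \sum_(x < b) trans p y x * w x = w y - 1.
  case: y => [b0|n nb]; first by rewrite sum_trans0// (wS 0%N)//; move: D0; lra.
  rewrite sum_transS// (wS n) ?(ltnW nb)// (wS n.+1)//.
  by have := DS n; lra.
have w0 x : 0 <= w x.
  apply: sumr_ge0 => k _; apply: sumr_ge0 => i _.
  by rewrite divr_ge0 ?expR_ge0// subr_ge0; case/andP: (p01 i) => _ /ltW.
have main t : \sum_(x < b) killed eta b t x * w x
    <= w r - t%:R * fine (Q (stays_below eta b t)).
  elim: t => [|t IH]; first by rewrite mul0r subr0 killed_recursion0.
  rewrite killed_recursion.
  under eq_bigr => y _ do rewrite step// mulrBr mulr1.
  rewrite sumrB; apply: le_trans (lerB IH (lexx _)) _.
  (* What remains is that survival up to [t.+1] is no likelier than survival up to [t]. *)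
  rewrite -addrA lerD2l sum_killed -opprD lerN2 -[X in _ + X]mul1r -mulrDl natr1.
  apply: ler_wpM2l => //; apply: fine_le.
  - by apply: fin_num_measure; exact: measurable_stays_below.
  - by apply: fin_num_measure; exact: measurable_stays_below.
  rewrite le_measure ?inE//; try exact: measurable_stays_below.
  by move=> x /= H s st; apply: H; exact: leqW.
have wle : w r <= b%:R ^+ 2 * del^-1 * expR (2 * M).
  pose c := del^-1 * expR (2 * M).
  have c0 : 0 <= c by rewrite mulr_ge0 ?expR_ge0// invr_ge0 ltW.
  have Dle x : (x < b)%N -> D x <= b%:R * c.
    move=> xb; apply: (@le_trans _ _ (\sum_(0 <= i < x.+1) c)).
      apply: ler_sum_nat => i /andP[_ ix].
      rewrite /c mulrC; apply: ler_pM; rewrite ?expR_ge0// ?invr_ge0.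
      - by rewrite (le_trans (ltW del0)).
      - by rewrite lef_pV2// posrE// (lt_le_trans del0).
      - rewrite ler_expR; have := VM x xb; have := VM i (leq_ltn_trans (_ : i <= x)%N xb).
        by move=> /(_ ix); rewrite !ler_norml; lra.
    by rewrite sumr_const_nat subn0 -[X in X <= _]mulr_natl ler_wpM2r// ler_nat.
  apply: (@le_trans _ _ (\sum_(r <= k < b) b%:R * c)).
    by apply: ler_sum_nat => k /andP[_ kb]; exact: Dle.
  rewrite sumr_const_nat -[X in X <= _]mulr_natl -mulrA -/c expr2 -mulrA ler_wpM2r//.
    by rewrite mulr_ge0.
  by rewrite ler_nat leq_subr.
apply: le_trans wle; rewrite -subr_ge0; apply: le_trans (main T).
by apply: sumr_ge0 => x _; rewrite mulr_ge0// killed_ge0.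
Qed.

End walk_estimates.

(** * Independence *)

Section past.
Context {d : measure_display} {T : measurableType d} {R : realType}.
Context {d' : measure_display} {T' : measurableType d'}.
Variables (P : probability T R) (X : nat -> {RV P >-> T'}).
Hypothesis indX : mutually_independent [set n | (0 < n)%N] X.

(** These cylinders form a pi-system on which independence is the hypothesis itself. The bounds
    leave out [X k], and [X 0], about which [indX] says nothing. *)
Definition past_cylinders (k : nat) : set (set T) :=
  [set B | exists2 A : nat -> set T', (forall i, measurable (A i)) &
    B = [set w | forall i, (0 < i < k)%N -> A i (X i w)]].

(* [T] with the sigma-algebra generated by [X 1, ..., X k.-1]. *)
Definition past (k : nat) := g_sigma_algebraType (past_cylinders k).

Lemma past_cylinders_measurable k B : past_cylinders k B -> measurable B.
Proof.
move=> [A mA ->].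
rewrite [X in measurable X](_ : _ =
  \bigcap_(i in [set i | (0 < i < k)%N]) (X i @^-1` A i)); last first.
  by apply/seteqP; split=> w /=.
by apply: bigcap_measurableType => i _; exact: measurable_funPTI.
Qed.

Lemma past_measurable k (B : set T) :
  (@measurable _ (past k) : set (set T)) B -> measurable B.
Proof.
move: B; apply: smallest_sub; first exact: sigma_algebra_measurable.
by move=> B; exact: past_cylinders_measurable.
Qed.

(** The sets independent of the event on [X k] form a Dynkin system, and mutual independence puts
    the generating cylinders in it. *)
Lemma past_independent k (B : set T) A : (0 < k)%N ->
  (@measurable _ (past k) : set (set T)) B -> measurable A ->
  P (B `&` X k @^-1` A) = (P B * P (X k @^-1` A))%E.
Proof.
move=> k0 mB mA.
have mXA : measurable (X k @^-1` A) by exact: measurable_funPTI.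
have mP := @past_measurable k.
move: B mB.
apply: (@dynkin_induction _ (past k) (past_cylinders k)
  [set B : set T | P (B `&` X k @^-1` A) = (P B * P (X k @^-1` A))%E]) => //.
- move=> _ _ [A1 mA1 ->] [A2 mA2 ->]; exists (fun i => A1 i `&` A2 i).
    by move=> i; exact: measurableI.
  apply/seteqP; split=> [w [H1 H2] i ik|w H].
    by split; [exact: H1|exact: H2].
  by split => i /H [].
- by rewrite /= setTI probability_setT mul1e.
- move=> _ [A' mA' ->] /=.
  pose A2 i := if i == k then A else A' i.
  have mA2 i : measurable (A2 i) by rewrite /A2; case: ifP.
  have ks : k \notin iota 1 k.-1 by rewrite mem_iota; lia.
  have us : uniq (k :: iota 1 k.-1) by rewrite /= ks iota_uniq.
  have sD : [set` iota 1 k.-1] `<=` [set n | (0 < n)%N].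
    by move=> i /=; rewrite mem_iota; lia.
  have sD' : [set` k :: iota 1 k.-1] `<=` [set n | (0 < n)%N].
    by move=> i /=; rewrite inE => /predU1P[->//|]; exact: sD.
  have E1 := indX us sD' mA2; have E2 := indX (iota_uniq 1 k.-1) sD mA'.
  rewrite [X in P (X `&` _)](_ : _ =
    \bigcap_(i in [set` iota 1 k.-1]) X i @^-1` A' i); last first.
    apply/seteqP; split=> w /= H i ik; apply: H; move: ik; rewrite /= mem_iota; lia.
  rewrite [X in _ = (P X * _)%E](_ : _ =
    \bigcap_(i in [set` iota 1 k.-1]) X i @^-1` A' i); last first.
    apply/seteqP; split=> w /= H i ik; apply: H; move: ik; rewrite /= mem_iota; lia.
  rewrite [X in P X](_ : _ = \bigcap_(i in [set` k :: iota 1 k.-1]) X i @^-1` A2 i).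
    rewrite E1 E2 big_cons /A2 eqxx muleC; congr (_ * _)%E.
    by rewrite big_seq [RHS]big_seq; apply: eq_bigr => i; case: eqVneq ks => [->/negP|].
  apply/seteqP; split=> [w [H HA] i /=|w H].
    rewrite inE /A2; case: eqVneq => [->//|_ /= ik]; exact: H.
  split.
    move=> i ik; have := H i; rewrite /= inE ik orbT /A2.
    by case: eqVneq ik ks => [-> ->//|_ _ _]; exact.
  by have := H k; rewrite /= inE eqxx /A2 eqxx; exact.
(* The complement and, below, the disjoint union are treated for sets measurable in [T], where [P]
   is a measure, and not in [past k]. *)
- suff H (S : set T) : measurable S ->
      P (S `&` X k @^-1` A) = (P S * P (X k @^-1` A))%E ->
      P (~` S `&` X k @^-1` A) = (P (~` S) * P (X k @^-1` A))%E.
    by move=> S /mP; exact: H.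
  move=> mS PS.
  rewrite setIC -setDE measureD//; last by rewrite -ge0_fin_numE ?fin_num_measure.
  rewrite [X in (_ - P X)%E]setIC PS probability_setC// muleBl ?mul1e//.
    by rewrite fin_num_measure.
- suff H (F : (set T)^nat) : (forall n, measurable (F n)) -> trivIset setT F ->
      (forall n, P (F n `&` X k @^-1` A) = (P (F n) * P (X k @^-1` A))%E) ->
      P (\bigcup_k F k `&` X k @^-1` A) = (P (\bigcup_k F k) * P (X k @^-1` A))%E.
    by move=> F mF; apply: H => n; exact: mP.
  move=> mF tF PF.
  rewrite setI_bigcupl measure_bigcup; last 2 first.
  - by move=> i _; exact: measurableI.
  - exact: trivIset_setIr.
  rewrite measure_bigcup//.
  rewrite muleC -(@fineK _ (P (X k @^-1` A))) ?fin_num_measure//.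
  rewrite -nneseriesZl//; apply: eq_eseriesr => i _.
  by rewrite fineK ?fin_num_measure// muleC; exact: PF.
Qed.
End past.

(** * Factorisation of expectations *)

Section independent_product.
Context {d : measure_display} {T : measurableType d} {R : realType}.
Variable P : probability T R.

Lemma bounded_integrable (f : T -> R) (M : R) :
  measurable_fun setT f -> (forall w, `|f w| <= M) -> P.-integrable setT (EFin \o f).
Proof.
move=> mf fM; apply: measurable_bounded_integrable => //.
  by rewrite -ge0_fin_numE ?fin_num_measure.
by exists M; split=> [|x Mx w _]; [exact: num_real | exact: le_trans (fM w) (ltW Mx)].
Qed.

(** The joint law of [f] and [g] agrees with the product of their laws on rectangles, hence
    everywhere, and Fubini separates the integral of [z.1 * z.2]. Boundedness supplies
    integrability. *)
Lemma Rintegral_independent_mul (f g : {mfun T >-> R}) (M : R) :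
  (forall w, `|f w| <= M) -> (forall w, `|g w| <= M) ->
  (forall A B, measurable A -> measurable B ->
    P (f @^-1` A `&` g @^-1` B) = (P (f @^-1` A) * P (g @^-1` B))%E) ->
  \int[P]_w (f w * g w) = \int[P]_w f w * \int[P]_w g w.
Proof.
move=> fM gM fg.
pose mu := distribution P f; pose nu := distribution P g.
have mfg : measurable_fun setT (fun w => (f w, g w)) by exact: measurable_fun_pair.
pose fgm : {mfun T >-> (R * R)%type} := mfun_Sub (mem_set mfg).
pose m' := distribution P fgm.
pose F (z : R * R) := (z.1 * z.2)%:E.
have mF : measurable_fun [set: (R * R)%type] F.
  by apply/measurable_EFinP; exact: measurable_funM.
have intF : P.-integrable setT (F \o fgm).
  apply: (@bounded_integrable (fun w => f w * g w) (M * M)); first exact: measurable_funM.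
  by move=> w; rewrite normrM ler_pM.
have mE X : measurable X -> (mu \x nu)%E X = m' X.
  by apply: product_measure_unique => A B mA mB; exact: fg.
have intm' : m'.-integrable setT F by exact: integrable_pushforward.
have intmunu : (mu \x nu)%E.-integrable setT F.
  apply/integrableP; split => //.
  rewrite (eq_measure_integral m').
    by have /integrableP[] := intm'.
  by move=> A mA _; exact: mE.
rewrite /Rintegral.
have -> : (\int[P]_w (f w * g w)%:E = \int[m']_z F z)%E.
  by rewrite integral_distribution.
rewrite -(@eq_measure_integral _ _ _ _ _ (mu \x nu)%E); last by move=> A mA _; exact: mE.
rewrite -integral12_prod_meas1// /fubini_F /F /=.
have intf : P.-integrable setT (EFin \o f) by exact: bounded_integrable fM.
have intg : P.-integrable setT (EFin \o g) by exact: bounded_integrable gM.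
have mid : measurable_fun setT (EFin : R -> \bar R) by exact/measurable_EFinP.
have intmu : mu.-integrable setT EFin by exact: integrable_pushforward.
have intnu : nu.-integrable setT EFin by exact: integrable_pushforward.
have nuE : (\int[nu]_y y%:E = (\int[P]_w g w)%:E)%E.
  rewrite integral_distribution// fineK//; exact: integrable_fin_num.
under eq_integral => x _.
  under eq_integral do rewrite EFinM.
  rewrite integralZl// nuE; over.
rewrite integralZr//= fineM//.
  by rewrite integral_distribution.
by rewrite integral_distribution//; exact: integrable_fin_num.
Qed.

End independent_product.

Section bounded_past.
Context {d : measure_display} {T : measurableType d} {R : realType}.
Context {d' : measure_display} {T' : measurableType d'}.
Variables (P : probability T R) (X : nat -> {RV P >-> T'}).
Local Notation Ex := (Rintegral P setT).

(** This class is closed under sums, products and indicators, and its members are integrable;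
    testing against them replaces conditional expectations given the past. *)
Definition bounded_past (k : nat) (f : T -> R) : Prop :=
  @measurable_fun _ _ (past X k) R setT f /\ exists M, forall w, `|f w| <= M.

Lemma past_mono k l (B : set T) : (k <= l)%N ->
  (@measurable _ (past X k) : set (set T)) B ->
  (@measurable _ (past X l) : set (set T)) B.
Proof.
move=> kl; move: B; apply: smallest_sub; first exact: sigma_algebra_measurable.
move=> _ [A mA ->]; apply: sub_sigma_algebra.
exists (fun i => if (i < k)%N then A i else setT); first by move=> i; case: ifP.
apply/seteqP; split=> [w H i il|w H i ik].
  by case: ifP => // ik; apply: H; lia.
by have := H i; case: (ltnP i k) => [_|]; [apply; lia|lia].
Qed.

Lemma bounded_past_mono k l f : (k <= l)%N -> bounded_past k f -> bounded_past l f.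
Proof.
move=> kl [mf bf]; split=> // mT Y mY.
by apply: (past_mono kl); exact: (mf _ Y mY).
Qed.

Lemma bounded_past_measurable k f : bounded_past k f -> measurable_fun setT f.
Proof.
move=> [mf _] mT Y mY; apply: (@past_measurable _ _ _ _ _ _ X k).
by apply: mf.
Qed.

Lemma bounded_past_integrable k f : bounded_past k f -> P.-integrable setT (EFin \o f).
Proof.
move=> bf; have mf := bounded_past_measurable bf.
by have [_ [M fM]] := bf; exact: bounded_integrable fM.
Qed.

Lemma bounded_past_cst k (c : R) : bounded_past k (fun=> c).
Proof. by split; [exact: measurable_cst | exists `|c|]. Qed.

Lemma bounded_pastD k f g : bounded_past k f -> bounded_past k g ->
  bounded_past k (fun w => f w + g w).
Proof.
move=> [mf [M fM]] [mg [N gN]]; split; first exact: measurable_funD.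
by exists (M + N) => w; rewrite (le_trans (ler_normD _ _))// lerD.
Qed.

Lemma bounded_pastM k f g : bounded_past k f -> bounded_past k g ->
  bounded_past k (fun w => f w * g w).
Proof.
move=> [mf [M fM]] [mg [N gN]]; split; first exact: measurable_funM.
by exists (M * N) => w; rewrite normrM ler_pM.
Qed.

Lemma bounded_pastX k f n : bounded_past k f -> bounded_past k (fun w => f w ^+ n).
Proof.
move=> bf; elim: n => [|n IH]; first exact: bounded_past_cst.
by under eq_fun do rewrite exprS; exact: bounded_pastM.
Qed.

Lemma bounded_past_indic k f (Y : set R) : measurable Y -> bounded_past k f ->
  bounded_past k (fun w => \1_Y (f w)).
Proof.
move=> mY [mf _]; split.
  have m1 : measurable_fun setT (\1_Y : R -> R) by exact: measurable_indic.
  exact: (measurableT_comp m1 mf).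
by exists 1 => w; rewrite indicE; case: (_ \in _); rewrite ?normr1 ?normr0.
Qed.

Lemma bounded_past_comp k l (phi : T' -> R) (B : R) : (0 < k < l)%N ->
  measurable_fun setT phi -> (forall y, `|phi y| <= B) ->
  bounded_past l (fun w => phi (X k w)).
Proof.
move=> kl mphi bphi; split; last by exists B.
move=> mT Y mY; rewrite setTI.
apply: sub_sigma_algebra.
exists (fun i => if i == k then phi @^-1` Y else setT).
  by move=> i; case: ifP => // _; rewrite -[X in measurable X]setTI; exact: mphi.
apply/seteqP; split=> [w H i il|w H]; first by case: eqP => // ->.
by have := H k kl; rewrite eqxx.
Qed.

Lemma ExD k f g : bounded_past k f -> bounded_past k g ->
  Ex (fun w => f w + g w) = Ex f + Ex g.
Proof.
by move=> bf bg; rewrite RintegralD//; exact: (@bounded_past_integrable k).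
Qed.

Lemma ExZ k c f : bounded_past k f -> Ex (fun w => c * f w) = c * Ex f.
Proof.
by move=> bf; rewrite RintegralZl//; exact: (@bounded_past_integrable k).
Qed.

Lemma le_Ex k f g : bounded_past k f -> bounded_past k g ->
  (forall w, f w <= g w) -> Ex f <= Ex g.
Proof.
by move=> bf bg fg; apply: le_Rintegral => //; exact: (@bounded_past_integrable k).
Qed.

Hypothesis indX : mutually_independent [set n | (0 < n)%N] X.

(** A function of the past is independent of [X k]. All the moment computations below rest on this
    factorisation. *)
Lemma Ex_past_mul k f (phi : T' -> R) (B : R) : (0 < k)%N -> bounded_past k f ->
  measurable_fun setT phi -> (forall y, `|phi y| <= B) ->
  Ex (fun w => f w * phi (X k w)) = Ex f * Ex (fun w => phi (X k w)).
Proof.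
move=> k0 bf mphi bphi; have mf := bounded_past_measurable bf.
have mg : measurable_fun setT (fun w => phi (X k w)).
  exact: (measurableT_comp mphi).
have [mf' [M fM]] := bf.
apply: (@Rintegral_independent_mul _ _ _ P (mfun_Sub (mem_set mf))
   (mfun_Sub (mem_set mg)) (Num.max M B)).
- by move=> w; rewrite le_max fM.
- by move=> w; rewrite le_max bphi orbT.
move=> A A' mA mA'.
have := @past_independent _ _ _ _ _ P X indX k (f @^-1` A) (phi @^-1` A') k0.
rewrite -[f @^-1` A]setTI -[phi @^-1` A']setTI.
by move=> /(_ (mf' measurableT A mA) (mphi measurableT A' mA')); rewrite !setTI.
Qed.

End bounded_past.

(** * Moments of block sums *)

Section moments.
Context {d : measure_display} {T : measurableType d} {R : realType}.
Context {d' : measure_display} {T' : measurableType d'}.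
Variables (P : probability T R) (X : nat -> {RV P >-> T'}).
Variables (phi : T' -> R) (B v : R).
Local Notation Ex := (Rintegral P setT).
Local Notation bp := (bounded_past X).
Hypothesis indX : mutually_independent [set n | (0 < n)%N] X.
Hypothesis mphi : measurable_fun setT phi.
Hypothesis bphi : forall y, `|phi y| <= B.
Hypothesis mean0 : forall k, (0 < k)%N -> Ex (fun w => phi (X k w)) = 0.
Hypothesis var : forall k, (0 < k)%N -> Ex (fun w => phi (X k w) ^+ 2) = v.

Definition psum (a n : nat) (w : T) : R := \sum_(a <= i < a + n) phi (X i w).

Lemma psum0 a w : psum a 0 w = 0.
Proof. by rewrite /psum addn0 big_geq. Qed.

Lemma psumS a n w : psum a n.+1 w = psum a n w + phi (X (a + n) w).
Proof. by rewrite /psum addnS big_nat_recr ?leq_addr. Qed.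

Lemma bounded_past_psum a n : (0 < a)%N -> bp (a + n) (psum a n).
Proof.
move=> a0; elim: n => [|n IH].
  rewrite (_ : psum a 0 = fun=> 0); first exact: bounded_past_cst.
  by apply/funext => w; rewrite psum0.
rewrite (_ : psum a n.+1 = fun w => psum a n w + phi (X (a + n) w)).
  apply: bounded_pastD; first by apply: bounded_past_mono IH; rewrite addnS.
  by apply: bounded_past_comp bphi => //; lia.
by apply/funext => w; rewrite psumS.
Qed.

Let B0 : 0 <= B. Proof. exact: le_trans (bphi point). Qed.

Lemma Ex_past_mulX k m f : (0 < k)%N -> bp k f ->
  Ex (fun w => f w * phi (X k w) ^+ m) = Ex f * Ex (fun w => phi (X k w) ^+ m).
Proof.
move=> k0 bf.
apply: (@Ex_past_mul _ _ _ _ _ P X indX k f (fun y => phi y ^+ m) (B ^+ m) k0 bf).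
  exact: measurable_funX.
by move=> y; rewrite normrX lerXn2r// ?nnegrE.
Qed.

Let mean1 k : (0 < k)%N -> Ex (fun w => phi (X k w) ^+ 1) = 0.
Proof. by move=> k0; under eq_Rintegral do rewrite expr1; exact: mean0. Qed.

Lemma Ex_past_mul1 k f : (0 < k)%N -> bp k f -> Ex (fun w => f w * phi (X k w)) = 0.
Proof. by move=> k0 bf; rewrite (Ex_past_mul indX k0 bf mphi bphi) mean0 ?mulr0. Qed.

Lemma Ex_past_mul2 k f : (0 < k)%N -> bp k f ->
  Ex (fun w => f w * phi (X k w) ^+ 2) = v * Ex f.
Proof. by move=> k0 bf; rewrite Ex_past_mulX// var// mulrC. Qed.

Lemma Ex_le_cst f (c : R) k : bp k f -> (forall w, f w <= c) -> Ex f <= c.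
Proof.
move=> bf fc; apply: le_trans (le_Ex bf (bounded_past_cst X k c) fc) _.
rewrite Rintegral_cst// -[leRHS]mulr1.
suff -> : fine (P [set: T]) = 1 by [].
by transitivity (fine 1%E : R) => //; congr fine; exact: probability_setT.
Qed.

Lemma Ex_past_mul4 k f : (0 < k)%N -> bp k f -> (forall w, 0 <= f w) ->
  Ex (fun w => f w * phi (X k w) ^+ 4) <= B ^+ 4 * Ex f.
Proof.
move=> k0 bf f0; rewrite Ex_past_mulX// mulrC ler_wpM2r//.
  by apply: Rintegral_ge0 => w _.
apply: (@Ex_le_cst _ _ k.+1).
  by apply: bounded_pastX; apply: bounded_past_comp bphi => //; lia.
move=> w; rewrite (exprM _ 2 2) (exprM B 2 2) lerXn2r// ?nnegrE ?sqr_ge0//.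
by rewrite -real_normK ?num_real// lerXn2r// ?nnegrE.
Qed.

Lemma variance_le : v <= B ^+ 2.
Proof.
rewrite -(var (ltn0Sn 0)); apply: (@Ex_le_cst _ _ 2).
  by apply: bounded_pastX; apply: bounded_past_comp bphi => //; lia.
by move=> w; rewrite -real_normK ?num_real// lerXn2r// ?nnegrE.
Qed.

Lemma variance_ge0 : 0 <= v.
Proof.
by rewrite -(var (ltn0Sn 0)); apply: Rintegral_ge0 => w _; rewrite sqr_ge0.
Qed.

Section weighted.
Variables (a : nat) (f : T -> R).
Hypotheses (a0 : (0 < a)%N) (bf : bp a f).

Let bfS n m : bp (a + n) (fun w => f w * psum a n w ^+ m).
Proof.
apply: bounded_pastM; first by apply: bounded_past_mono bf; exact: leq_addr.
exact/bounded_pastX/bounded_past_psum.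
Qed.

Let bfX n m : bp (a + n).+1 (fun w => phi (X (a + n) w) ^+ m).
Proof. by apply: bounded_pastX; apply: bounded_past_comp bphi => //; lia. Qed.

Let an0 n : (0 < a + n)%N. Proof. by rewrite addn_gt0 a0. Qed.

Let bfSX n m l : bp (a + n).+1 (fun w => f w * psum a n w ^+ m * phi (X (a + n) w) ^+ l).
Proof. by apply: bounded_pastM => //; apply: bounded_past_mono (bfS n m). Qed.

(** The weight [f] belongs to the past of the block; letting it range over such functions states
    moments conditional on that past. *)
Lemma weighted_moment1 n : Ex (fun w => f w * psum a n w) = 0.
Proof.
elim: n => [|n IH].
  under eq_Rintegral do rewrite psum0 mulr0.
  by rewrite Rintegral_cst// mul0r.
have bfn : bp (a + n) f by apply: bounded_past_mono bf; exact: leq_addr.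
have b1 := bfSX n 1 0; have b2 := bfSX n 0 1.
transitivity (Ex (fun w => f w * psum a n w ^+ 1 * phi (X (a + n) w) ^+ 0 +
    f w * psum a n w ^+ 0 * phi (X (a + n) w) ^+ 1)).
  by apply: eq_Rintegral => w _; rewrite psumS !expr0 !expr1; ring.
rewrite (ExD b1 b2).
under eq_Rintegral do rewrite expr0 mulr1 expr1.
rewrite IH add0r.
under eq_Rintegral do rewrite expr0 mulr1 expr1.
exact: Ex_past_mul1.
Qed.

Lemma weighted_moment2 n : Ex (fun w => f w * psum a n w ^+ 2) = n%:R * v * Ex f.
Proof.
elim: n => [|n IH].
  under eq_Rintegral do rewrite psum0 expr0n /= mulr0.
  by rewrite Rintegral_cst// !mul0r.
have bfn : bp (a + n) f by apply: bounded_past_mono bf; exact: leq_addr.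
have b1 := bfSX n 2 0; have b2 := bfSX n 1 1; have b3 := bfSX n 0 2.
transitivity (Ex (fun w => f w * psum a n w ^+ 2 * phi (X (a + n) w) ^+ 0 +
   (2 * (f w * psum a n w ^+ 1 * phi (X (a + n) w) ^+ 1) +
    f w * psum a n w ^+ 0 * phi (X (a + n) w) ^+ 2))).
  by apply: eq_Rintegral => w _; rewrite psumS !expr0 !expr1; ring.
have b2' := bounded_pastM (bounded_past_cst X _ 2) b2.
rewrite (ExD b1 (bounded_pastD b2' b3)) (ExD b2' b3) (ExZ _ b2).
under eq_Rintegral do rewrite expr0 mulr1.
rewrite IH Ex_past_mulX// mean1//.
under [X in _ + (_ + X)]eq_Rintegral do rewrite expr0 mulr1.
by rewrite Ex_past_mul2// -natr1; ring.
Qed.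

Hypothesis f0 : forall w, 0 <= f w.

(** In the expansion of the fourth power the terms with [phi] to the powers 1 and 3 vanish, the
    latter because [psum] itself is centred. The other two add at most [6 n + 1] times
    [B ^+ 4 * Ex f], less than the gain [6 n + 3] of [3 (n + 1)^2]. *)
Lemma weighted_moment4 n :
  Ex (fun w => f w * psum a n w ^+ 4) <= 3 * n%:R ^+ 2 * B ^+ 4 * Ex f.
Proof.
have Ef0 : 0 <= Ex f by apply: Rintegral_ge0.
elim: n => [|n IH].
  under eq_Rintegral do rewrite psum0 expr0n /= mulr0.
  by rewrite Rintegral_cst// expr0n /= mulr0 !mul0r.
have bfn : bp (a + n) f by apply: bounded_past_mono bf; exact: leq_addr.
have b0 := bfSX n 4 0; have b1 := bfSX n 3 1; have b2 := bfSX n 2 2.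
have b3 := bfSX n 1 3; have b4 := bfSX n 0 4.
have -> : Ex (fun w => f w * psum a n.+1 w ^+ 4) =
  Ex (fun w => f w * psum a n w ^+ 4 * phi (X (a + n) w) ^+ 0 +
   (4 * (f w * psum a n w ^+ 3 * phi (X (a + n) w) ^+ 1) +
   (6 * (f w * psum a n w ^+ 2 * phi (X (a + n) w) ^+ 2) +
   (4 * (f w * psum a n w ^+ 1 * phi (X (a + n) w) ^+ 3) +
    f w * psum a n w ^+ 0 * phi (X (a + n) w) ^+ 4)))).
  by apply: eq_Rintegral => w _; rewrite psumS !expr0 !expr1; ring.
have b1' := bounded_pastM (bounded_past_cst X _ 4) b1.
have b2' := bounded_pastM (bounded_past_cst X _ 6) b2.
have b3' := bounded_pastM (bounded_past_cst X _ 4) b3.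
have b34 := bounded_pastD b3' b4; have b24 := bounded_pastD b2' b34.
rewrite (ExD b0 (bounded_pastD b1' b24)) (ExD b1' b24) (ExD b2' b34) (ExD b3' b4).
rewrite (ExZ _ b1) (ExZ _ b2) (ExZ _ b3).
under eq_Rintegral do rewrite expr0 mulr1.
have -> : Ex (fun w => f w * psum a n w ^+ 0 * phi (X (a + n) w) ^+ 4) =
    Ex (fun w => f w * phi (X (a + n) w) ^+ 4).
  by apply: eq_Rintegral => w _; rewrite expr0 mulr1.
rewrite (Ex_past_mulX 1 (an0 n) (bfS n 3)) (Ex_past_mulX 2 (an0 n) (bfS n 2)).
rewrite (Ex_past_mulX 3 (an0 n) (bfS n 1)) mean1// var// weighted_moment2.
have -> : Ex (fun w => f w * psum a n w ^+ 1) = 0 by rewrite -(weighted_moment1 n).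
have := Ex_past_mul4 (an0 n) bfn f0.
have v2 : v * v <= B ^+ 4.
  by rewrite (exprM B 2 2) expr2 ler_pM ?variance_ge0 ?variance_le.
have h : 0 <= n%:R * Ex f * (B ^+ 4 - v * v).
  by rewrite mulr_ge0 ?mulr_ge0 ?subr_ge0.
move: IH h; rewrite -natr1; move: (Ex _) (Ex f) Ef0 => e1 e2 e20.
have h2 : 0 <= B ^+ 4 * e2 by rewrite mulr_ge0// exprn_ge0.
by nra.
Qed.

End weighted.
End moments.

(** * Limit superior and limit inferior of events *)

Section limit_sets.
Context {d : measure_display} {T : measurableType d} {R : realType}.
Variable P : probability T R.

(** Borel-Cantelli, the probabilities being dominated by a geometric series of sum [C / (1 - q)]. *)
Lemma ae_eventually_not (A : (set T)^nat) (C q : R) :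
  (forall k, measurable (A k)) -> 0 <= q < 1 ->
  (forall k, (P (A k) <= (C * q ^+ k)%:E)%E) ->
  {ae P, forall w, \forall k \near \oo, ~ A k w}.
Proof.
move=> mA /andP[q0 q1] PA.
have C0 : 0 <= C.
  by have := le_trans (measure_ge0 P (A 0%N)) (PA 0%N); rewrite expr0 mulr1 lee_fin.
have : P (lim_sup_set A) = 0%E.
  apply: lim_sup_set_cvg0 => //.
  apply: (@le_lt_trans _ _ (C / (1 - q))%:E); last exact: ltry.
  apply: lime_le; first exact: is_cvg_nneseries.
  apply: nearW => n.
  apply: (@le_trans _ _ (\sum_(0 <= k < n) (C * q ^+ k)%:E)%E).
    by apply: lee_sum => k _; exact: PA.
  rewrite sumEFin lee_fin -mulr_sumr ler_wpM2l// -(ler_pM2r (_ : 0 < 1 - q)) ?subr_gt0//.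
  rewrite mulVf ?gt_eqF ?subr_gt0// mulrC big_mkord -opprB mulNr -subrX1 opprB.
  by rewrite gerBl exprn_ge0.
move=> P0; exists (lim_sup_set A); split => //.
  apply: bigcap_measurable; first by exists 0%N.
  by move=> n _; apply: bigcup_measurable.
move=> w /= H n _; apply: contrapT => h; apply: H.
by exists n => // k /= nk Ak; apply: h; exists k.
Qed.

(** The intersections increase with [N], and each lies in some [A n] of measure at most [e];
    continuity from below concludes. *)
Lemma measure_liminf_le (A : (set T)^nat) (e : R) :
  (forall k, measurable (A k)) ->
  (forall N, exists2 n, (N <= n)%N & (P (A n) <= e%:E)%E) ->
  (P (\bigcup_N \bigcap_(n in [set n | (N <= n)%N]) A n) <= e%:E)%E.
Proof.
move=> mA PA; pose D N := \bigcap_(n in [set n | (N <= n)%N]) A n.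
have mD N : measurable (D N) by apply: bigcap_measurableType => n _.
have mU : measurable (\bigcup_N D N) by exact: bigcup_measurable.
have ndD : nondecreasing_seq D.
  move=> m n mn; apply/subsetPset => w Dw k /= nk; apply: Dw.
  exact: leq_trans nk.
have := nondecreasing_cvg_mu mD mU ndD => /(_ R P) cv.
rewrite -(cvg_lim _ cv)//; apply: lime_le; first by apply/cvg_ex; eexists; exact: cv.
apply: nearW => N; have [n Nn PAn] := PA N.
by apply: le_trans PAn; rewrite /= le_measure ?inE//; exact: bigcap_inf.
Qed.

End limit_sets.

Section polynomial_test.
Context {R : realType}.

(* For [y <= 0] the term [y / e] absorbs the parabola near 0 and the quartic
   absorbs it further away, so positivity forces [y >= c]. *)
Lemma quartic_test (e b c y : R) : 0 < e -> 0 <= c <= 1 -> c * (e^-1 + 1) <= b ->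
  y / e + y ^+ 2 - e ^+ 2 * y ^+ 4 - b <= (5 / 4) / e ^+ 2 * (c <= y)%R%:R.
Proof.
move=> e0 /andP[c0 c1] cb.
have e1 : 0 < e^-1 by rewrite invr_gt0.
have b0 : 0 <= b by apply: le_trans cb; rewrite mulr_ge0// addr_ge0// ltW.
have y4 : 0 <= e ^+ 2 * y ^+ 4.
  by rewrite mulr_ge0 ?sqr_ge0// (exprM y 2 2) sqr_ge0.
have [cy|yc] := lerP c y; rewrite ?mulr1 ?mulr0.
  (* Two completed squares: [y / e <= y^2 + 1 / (4 e^2)] and [2 y^2 <= e^2 y^4 + 1 / e^2], whence
     the constant [5 / 4]. *)
  have h1 : 0 <= (y - e^-1 / 2) ^+ 2 by exact: sqr_ge0.
  have h2 : 0 <= (e * y ^+ 2 - e^-1) ^+ 2 by exact: sqr_ge0.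
  have h3 : e * e^-1 = 1 by rewrite mulfV// gt_eqF.
  rewrite -exprVn.
  have h4 : (e * y ^+ 2 - e^-1) ^+ 2 = e ^+ 2 * y ^+ 4 - 2 * (e * e^-1) * y ^+ 2 + e^-1 ^+ 2.
    by ring.
  rewrite h4 h3 in h2.
  by nra.
have [y0|y0] := lerP 0 y.
  have h1 : y / e <= c / e by rewrite ler_wpM2r// ltW.
  have h2 : y ^+ 2 <= c by rewrite expr2; nra.
  by move: cb; rewrite mulrDr mulr1; lra.
have [ye|ye] := lerP (- y) e^-1.
  have h : 0 <= - y * (e^-1 + y) by rewrite mulr_ge0//; lra.
  by rewrite expr2; nra.
have h1 : 0 <= - (y / e) by rewrite -mulNr divr_ge0// ?oppr_ge0 ltW.
have h2 : 1 <= e ^+ 2 * y ^+ 2.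
  rewrite -exprMn -[leRHS]sqrrN -mulrN expr_ge1// ?mulr_ge0 ?oppr_ge0// ?(ltW e0) ?(ltW y0)//.
  by rewrite mulrC -ler_pdivrMr// div1r ltW.
have h3 : y ^+ 2 <= e ^+ 2 * y ^+ 4.
  by rewrite (exprM y 2 2) [y ^+ 2 ^+ 2]expr2 mulrA -[leLHS]mul1r ler_wpM2r// sqr_ge0.
by lra.
Qed.

End polynomial_test.

(** * Fluctuations of sums of bounded centred variables *)

Section fluctuations.
Context {d : measure_display} {T : measurableType d} {R : realType}.
Context {d' : measure_display} {T' : measurableType d'}.
Variables (P : probability T R) (X : nat -> {RV P >-> T'}).
Variables (phi : T' -> R) (B v : R).
Local Notation Ex := (Rintegral P setT).
Local Notation bp := (bounded_past X).
Local Notation psum := (psum X phi).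
Hypothesis indX : mutually_independent [set n | (0 < n)%N] X.
Hypothesis mphi : measurable_fun setT phi.
Hypothesis bphi : forall y, `|phi y| <= B.
Hypothesis mean0 : forall k, (0 < k)%N -> Ex (fun w => phi (X k w)) = 0.
Hypothesis var : forall k, (0 < k)%N -> Ex (fun w => phi (X k w) ^+ 2) = v.

Lemma measurable_psum a n : measurable_fun setT (psum a n).
Proof.
rewrite /psum; apply: measurable_sum => i.
exact: (measurableT_comp mphi).
Qed.

(** [quartic_test] is evaluated at [psum a n w / Num.sqrt n%:R] and integrated against [f]. The
    linear term vanishes by centring, the square gives [v], and the fourth moment is bounded
    uniformly in [n], so the event of a positive rise must carry a fixed share of [Ex f]. *)
Lemma block_rise : 0 < v -> exists c p0 : R, [/\ 0 < c, 0 < p0 < 1 &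
  forall a n f, (0 < a)%N -> (0 < n)%N -> bp a f -> (forall w, 0 <= f w) ->
  p0 * Ex f <=
  Ex (fun w => f w * \1_[set y | c * Num.sqrt n%:R <= y] (psum a n w))].
Proof.
move=> v0.
have vB := variance_le mphi bphi var.
have B2 : 0 < B ^+ 2 by exact: lt_le_trans vB.
(* This [e] brings the quartic term down to [3 / 16 * v]; with [b = v / 4], at least [v / 2] remains
   on the left. *)
pose e : R := Num.sqrt v / (4 * B ^+ 2).
have e0 : 0 < e by rewrite divr_gt0 ?sqrtr_gt0// mulr_gt0.
have e2 : e ^+ 2 * (16 * B ^+ 4) = v.
  rewrite /e expr_div_n sqr_sqrtr ?ltW// (exprM B 2 2) exprMn.
  by field; rewrite -sqrf_eq0 gt_eqF.
pose b : R := v / 4.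
pose c : R := Num.min 1 (b / (e^-1 + 1)).
have ei0 : 0 < e^-1 + 1 by rewrite addr_gt0// invr_gt0.
have c0 : 0 < c by rewrite lt_min ltr01 /= divr_gt0// /b divr_gt0.
have c1 : c <= 1 by rewrite ge_min lexx.
have cb : c * (e^-1 + 1) <= b by rewrite -ler_pdivlMr// ge_min lexx orbT.
pose M : R := (5 / 4) / e ^+ 2.
have M0 : 0 < M by rewrite divr_gt0// exprn_gt0.
exists c, (Num.min (1 / 2) ((v / 2) / M)); split => //.
  apply/andP; split; last by rewrite gt_min; apply/orP; left; lra.
  rewrite lt_min; apply/andP; split; first lra.
  by apply: divr_gt0 => //; exact: divr_gt0.
move=> a n f a0 n0 bf f0.
have Ef0 : 0 <= Ex f by apply: Rintegral_ge0.
pose s : R := Num.sqrt (n%:R : R).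
have s0 : 0 < s by rewrite sqrtr_gt0 ltr0n.
have s2 : s ^+ 2 = n%:R by rewrite sqr_sqrtr.
pose Y := [set y : R | c * s <= y].
have mY : measurable Y.
  rewrite (_ : Y = `[c * s, +oo[%classic); first exact: measurable_itv.
  by apply/seteqP; split=> y; rewrite /= in_itv /= andbT.
have bSn : bp (a + n) (psum a n) by exact: (bounded_past_psum X mphi bphi).
have bfn : bp (a + n) f by apply: bounded_past_mono bf; exact: leq_addr.
have b1 : bp (a + n) (fun w => f w * psum a n w) by exact: bounded_pastM.
have b2 : bp (a + n) (fun w => f w * psum a n w ^+ 2).
  by apply: bounded_pastM => //; exact: bounded_pastX.
have b4 : bp (a + n) (fun w => f w * psum a n w ^+ 4).
  by apply: bounded_pastM => //; exact: bounded_pastX.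
have bI : bp (a + n) (fun w => f w * \1_Y (psum a n w)).
  by apply: bounded_pastM => //; exact: bounded_past_indic.
have pt w : (e * s)^-1 * (f w * psum a n w) + ((s ^+ 2)^-1 * (f w * psum a n w ^+ 2) +
    (- (e ^+ 2 / s ^+ 4) * (f w * psum a n w ^+ 4) + - b * f w)) <=
    M * (f w * \1_Y (psum a n w)).
  have := @quartic_test _ e b c (psum a n w / s) e0 _ cb.
  rewrite (ltW c0) c1 => /(_ isT) /(ler_wpM2l (f0 w)).
  rewrite -/M ler_pdivlMr//.
  rewrite indicE mem_setE /= [f w * (M * _)]mulrCA.
  apply: le_trans; rewrite le_eqVlt; apply/orP; left; apply/eqP.
  by field; rewrite !gt_eqF.
have bc (c' : R) g : bp (a + n) g -> bp (a + n) (fun w => c' * g w).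
  by move=> bg; apply: bounded_pastM => //; exact: bounded_past_cst.
have t1 := bc (e * s)^-1 _ b1; have t2 := bc (s ^+ 2)^-1 _ b2.
have t3 := bc (- (e ^+ 2 / s ^+ 4)) _ b4; have t4 := bc (- b) _ bfn.
have t34 := bounded_pastD t3 t4; have t234 := bounded_pastD t2 t34.
have := le_Ex (bounded_pastD t1 t234) (bc M _ bI) pt.
rewrite (ExD t1 t234) (ExD t2 t34) (ExD t3 t4) (ExZ _ b1) (ExZ _ b2) (ExZ _ b4).
rewrite (ExZ _ bfn) (ExZ _ bI).
rewrite (weighted_moment1 indX mphi bphi mean0 a0 bf).
rewrite (weighted_moment2 indX mphi bphi mean0 var a0 bf).
have m4 := weighted_moment4 indX mphi bphi mean0 var a0 bf f0 n.
rewrite mulr0 add0r s2 => h.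
have n0' : (n%:R : R) != 0 by rewrite pnatr_eq0 -lt0n.
have h4 : e ^+ 2 / s ^+ 4 * Ex (fun w => f w * psum a n w ^+ 4) <= 3 / 16 * v * Ex f.
  apply: (@le_trans _ _ (e ^+ 2 / s ^+ 4 * (3 * n%:R ^+ 2 * B ^+ 4 * Ex f))).
    by apply: ler_wpM2l => //; rewrite divr_ge0 ?sqr_ge0// (exprM s 2 2) sqr_ge0.
  rewrite (exprM s 2 2) s2 -e2 le_eqVlt; apply/orP; left; apply/eqP.
  by field.
have h2 : n%:R^-1 * (n%:R * v * Ex f) = v * Ex f by field.
rewrite h2 mulNr in h.
apply: (@le_trans _ _ ((v / 2) / M * Ex f)).
  by rewrite ler_wpM2r// ge_min lexx orbT.
rewrite mulrAC ler_pdivrMr// [leRHS]mulrC; apply: le_trans h.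
rewrite /b; nra.
Qed.

Definition no_rise (c : R) (a n m : nat) : set T :=
  [set w | forall j, (j < m)%N -> psum (a + j * n) n w < c * Num.sqrt n%:R].

Lemma measurable_no_rise c a n m : measurable (no_rise c a n m).
Proof.
rewrite [X in measurable X](_ : _ = \bigcap_(j in [set j | (j < m)%N])
   (psum (a + j * n) n @^-1` `]-oo, c * Num.sqrt n%:R[)); last first.
  apply/seteqP; split=> w H j /H; by rewrite /= in_itv.
apply: bigcap_measurableType => j _.
rewrite -[X in measurable X]setTI; apply: measurable_psum => //.
Qed.

(** The indicator [G l] of no rise in the first [l] blocks is a nonnegative weight from the past of
    the next block, so [block_rise] gives a factor [1 - p0] per block. *)
Lemma no_rise_prob : 0 < v -> exists c p0 : R, [/\ 0 < c, 0 < p0 < 1 &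
  forall a n m, (0 < a)%N -> (0 < n)%N ->
  (P (no_rise c a n m) <= ((1 - p0) ^+ m)%:E)%E].
Proof.
move=> v0; have [c [p0 [c0 p01 rise]]] := block_rise v0.
exists c, p0; split => // a n m a0 n0.
pose Y := [set y : R | c * Num.sqrt n%:R <= y].
have mY : measurable Y.
  rewrite (_ : Y = `[c * Num.sqrt n%:R, +oo[%classic); first exact: measurable_itv.
  by apply/seteqP; split=> y; rewrite /= in_itv /= andbT.
pose G m w := \prod_(j < m) (1 - \1_Y (psum (a + j * n) n w) : R).
have GS l w : G l.+1 w = G l w * (1 - \1_Y (psum (a + l * n) n w)).
  by rewrite /G big_ord_recr.
have G0 l w : 0 <= G l w.
  apply: prodr_ge0 => j _; rewrite subr_ge0 indicE; by case: (_ \in _).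
have bI l : bp (a + l.+1 * n) (fun w => \1_Y (psum (a + l * n) n w)).
  apply: bounded_past_indic => //.
  have -> : (a + l.+1 * n = a + l * n + n)%N by rewrite mulSn; lia.
  by apply: (bounded_past_psum X mphi bphi); rewrite addn_gt0 a0.
have bG l : bp (a + l * n) (G l).
  elim: l => [|l IH].
    rewrite (_ : G 0%N = fun=> 1); first exact: bounded_past_cst.
    by apply/funext => w; rewrite /G big_ord0.
  rewrite (_ : G l.+1 = fun w => G l w * (1 + -1 * \1_Y (psum (a + l * n) n w))).
    apply: bounded_pastM.
      by apply: bounded_past_mono IH; rewrite leq_add2l leq_mul2r leqnSn orbT.
    apply: bounded_pastD; first exact: bounded_past_cst.
    by apply: bounded_pastM => //; exact: bounded_past_cst.
  by apply/funext => w; rewrite GS mulN1r.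
have EG l : Ex (G l) <= (1 - p0) ^+ l.
  elim: l => [|l IH].
    by apply: (Ex_le_cst (bG 0%N)) => w; rewrite /G big_ord0.
  have b1 := bounded_past_mono (_ : a + l * n <= a + l.+1 * n)%N (bG l).
  have {}b1 : bp (a + l.+1 * n) (G l) by apply: b1; rewrite leq_add2l leq_mul2r leqnSn orbT.
  have b2 := bounded_pastM b1 (bI l).
  have -> : Ex (G l.+1) = Ex (fun w => G l w + -1 * (G l w * \1_Y (psum (a + l * n) n w))).
    by apply: eq_Rintegral => w _; rewrite -/(G l.+1 w) GS; ring.
  rewrite (ExD b1 (bounded_pastM (bounded_past_cst X _ (-1)) b2)) (ExZ _ b2) mulN1r.
  have al0 : (0 < a + l * n)%N by rewrite addn_gt0 a0.
  have := rise _ n _ al0 n0 (bG l) (G0 l); rewrite -/Y => h.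
  apply: (@le_trans _ _ ((1 - p0) * Ex (G l))); first by move: h; lra.
  by rewrite exprS ler_wpM2l// subr_ge0; case/andP: p01 => _ /ltW.
have mN := measurable_no_rise c a n m.
rewrite -(@fineK _ (P _)) ?fin_num_measure// lee_fin.
apply: le_trans (EG m).
have -> : fine (P (no_rise c a n m)) = Ex (\1_(no_rise c a n m)).
  by rewrite /Rintegral -[in LHS](setIT (no_rise c a n m)) -integral_indic.
rewrite le_eqVlt; apply/orP; left; apply/eqP.
apply: eq_Rintegral => w _; rewrite -/(G m w) -/(\1_(no_rise c a n m) w) indicE.
have [/set_mem wN|wN] := boolP (w \in no_rise c a n m).
  rewrite /G big1// => j _; rewrite indicE memNset ?subr0//=.
  by apply/negP; rewrite -ltNge; exact: wN.
suff [j [jm hj]] : exists j, (j < m)%N /\ c * Num.sqrt n%:R <= psum (a + j * n) n w.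
  rewrite /G (bigD1 (Ordinal jm))//= indicE mem_set ?subrr ?mul0r//.
apply: contrapT => H; move/negP: wN; apply; apply: mem_set => j jm.
by rewrite ltNge; apply/negP => hj; apply: H; exists j.
Qed.

End fluctuations.

(** * Almost sure rises and almost sure small maxima *)

Section environment_estimates.
Context {d : measure_display} {T : measurableType d} {R : realType}.
Context {d' : measure_display} {T' : measurableType d'}.
Variables (P : probability T R) (X : nat -> {RV P >-> T'}).
Variables (phi : T' -> R) (B v : R).
Local Notation Ex := (Rintegral P setT).
Local Notation bp := (bounded_past X).
Local Notation psum := (psum X phi).
Hypothesis indX : mutually_independent [set n | (0 < n)%N] X.
Hypothesis mphi : measurable_fun setT phi.
Hypothesis bphi : forall y, `|phi y| <= B.
Hypothesis mean0 : forall k, (0 < k)%N -> Ex (fun w => phi (X k w)) = 0.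
Hypothesis var : forall k, (0 < k)%N -> Ex (fun w => phi (X k w) ^+ 2) = v.

Lemma sqrt_exp4 k : Num.sqrt ((4 ^ k)%:R : R) = 2 ^+ k.
Proof.
rewrite (_ : (4 ^ k)%:R = (2 ^+ k) ^+ 2 :> R).
  by rewrite sqrtr_sqr ger0_norm// exprn_ge0.
by rewrite -exprM mulnC exprM natrX -[2 ^+ 2]natrX.
Qed.

(** Length [4 ^ k] makes the typical fluctuation [2 ^ k], and [k] blocks make the failure
    probability geometric. Starting beyond [k * 4 ^ k] keeps the perturbation of a block of order
    [2 ^ k / sqrt k]; the [+ 1] matches increments of the potential from [k * 4 ^ k]. *)
Lemma ae_rise : 0 < v -> exists2 c : R, 0 < c &
  {ae P, forall w, \forall k \near \oo, exists2 j, (j < k)%N &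
    c * 2 ^+ k <= psum (k * 4 ^ k + 1 + j * 4 ^ k) (4 ^ k) w}.
Proof.
move=> v0; have [c [p0 [c0 /andP[p00 p01] rise]]] := no_rise_prob indX mphi bphi mean0 var v0.
exists c => //.
pose A k := no_rise X phi c (k * 4 ^ k + 1) (4 ^ k) k.
have mA k : measurable (A k) by exact: measurable_no_rise.
have q01 : 0 <= 1 - p0 < 1 by apply/andP; split; lra.
have PA k : (P (A k) <= (1 * (1 - p0) ^+ k)%:E)%E.
  by rewrite mul1r; apply: rise; rewrite ?addn1// expn_gt0.
have := ae_eventually_not mA q01 PA.
apply: filterS => w; apply: filterS => k /= nA.
apply: contrapT => H; apply: nA => j jk.
rewrite ltNge sqrt_exp4; apply/negP => hj; apply: H; by exists j.
Qed.

(* The sums [psum 1 n] stopped when they first reach [c] in absolute value. *)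
Fixpoint stopped_sum (c : R) (n : nat) (w : T) : R :=
  if n is k.+1 then stopped_sum c k w +
    \prod_(j < k.+1) \1_[set y | `|y| < c] (psum 1 j w) * phi (X k.+1 w)
  else 0.

Lemma stopped_sum_ge c n w k : (k <= n)%N -> c <= `|psum 1 k w| -> c <= `|stopped_sum c n w|.
Proof.
(* Dichotomy at time [m]: either the level was reached strictly before [m] and the stopped sum is
   frozen above it, or the stopped sum still equals [psum 1 m]. *)
pose bad m := exists2 k, (k < m)%N & c <= `|psum 1 k w|.
have inv m : (bad m /\ c <= `|stopped_sum c m w|) \/
    (~ bad m /\ stopped_sum c m w = psum 1 m w).
  elim: m => [|m [[bm cm]|[nbm sm]]].
  - by right; split; [case | rewrite psum0].
  - left; split; first by have [i im ci] := bm; exists i => //; rewrite ltnS ltnW.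
    have [i im ci] := bm; rewrite /= (bigD1 (Ordinal (ltnW im : i < m.+1)%N))//=.
    rewrite indicE memNset; first by rewrite !mul0r addr0.
    by apply/negP; rewrite -leNgt.
  - have [cm|cm] := lerP c `|psum 1 m w|.
      left; split; first by exists m.
      rewrite /= big_ord_recr /= [X in _ * X * _]indicE memNset /=; last first.
        by apply/negP; rewrite -leNgt.
      by rewrite mulr0 mul0r addr0 sm.
    right; split.
      move=> [i]; rewrite ltnS leq_eqVlt => /predU1P[-> ci|im ci]; first by rewrite ltNge ci in cm.
      by apply: nbm; exists i.
    rewrite psumS /= sm add1n big1 ?mul1r// => j _.
    rewrite indicE mem_set//= ltNge; apply/negP => cj.
    have := ltn_ord j; rewrite ltnS leq_eqVlt => /predU1P[jm|jm].
      by rewrite jm leNgt cm in cj.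
    by apply: nbm; exists j.
move=> kn ck; have [[_ //]|[nb ->]] := inv n.
move: kn; rewrite leq_eqVlt => /predU1P[<-//|kn].
by case: nb; exists k.
Qed.

(** The increments of the stopped sum are orthogonal and its factor [G] is at most 1, so its second
    moment is at most [n * v]; [stopped_sum_ge] and Chebyshev's inequality then give the bound on
    the maximum. *)
Lemma kolmogorov_maximal (c : R) n : 0 < c ->
  (P [set w | exists2 k, (k <= n)%N & (c <= `|psum 1 k w|)%R] <=
    (n%:R * v / c ^+ 2)%:E)%E.
Proof.
move=> c0; pose Y := [set y : R | `|y| < c].
have mY : measurable Y.
  rewrite (_ : Y = `]-c, c[%classic); first exact: measurable_itv.
  by apply/seteqP; split=> y; rewrite /Y /= in_itv /= ltr_norml.
pose G k w := \prod_(j < k.+1) \1_Y (psum 1 j w) : R.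
have bG k : bp k.+1 (G k).
  elim: k => [|k IH].
    rewrite (_ : G 0%N = fun=> \1_Y 0); first exact: bounded_past_cst.
    by apply/funext => w; rewrite /G big_ord_recl big_ord0 mulr1 psum0.
  rewrite (_ : G k.+1 = fun w => G k w * \1_Y (psum 1 k.+1 w)).
    apply: bounded_pastM; first exact: bounded_past_mono IH.
    apply: bounded_past_indic => //.
    exact: (bounded_past_psum X mphi bphi k.+1 (ltn0Sn 0)).
  by apply/funext => w; rewrite /G big_ord_recr.
have bS k : bp k.+1 (stopped_sum c k).
  elim: k => [|k IH]; first exact: bounded_past_cst.
  apply: (@bounded_pastD _ _ _ _ _ _ X _ (stopped_sum c k) (fun w => G k w * phi (X k.+1 w))).
    exact: bounded_past_mono IH.
  apply: bounded_pastM; first exact: bounded_past_mono (bG k).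
  by apply: bounded_past_comp bphi => //; lia.
have v0 : 0 <= v by rewrite -(var (ltn0Sn 0)); apply: Rintegral_ge0 => w _; rewrite sqr_ge0.
have ES k : Ex (fun w => stopped_sum c k w ^+ 2) <= k%:R * v.
  elim: k => [|k IH].
    rewrite mul0r (@eq_Rintegral _ _ _ _ _ (fun=> 0)); first by rewrite Rintegral_cst// mul0r.
    by move=> w _; rewrite /= expr0n.
  have b1 : bp k.+2 (fun w => stopped_sum c k w ^+ 2).
    by apply: bounded_pastX; apply: bounded_past_mono (bS k).
  have bSG : bp k.+1 (fun w => stopped_sum c k w * G k w) by exact: bounded_pastM.
  have bGG : bp k.+1 (fun w => G k w ^+ 2) by exact: bounded_pastX.
  have bx : bp k.+2 (fun w => phi (X k.+1 w)).
    by apply: bounded_past_comp bphi => //; lia.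
  have b2 : bp k.+2 (fun w => stopped_sum c k w * G k w * phi (X k.+1 w)).
    by apply: bounded_pastM => //; exact: bounded_past_mono bSG.
  have b3 : bp k.+2 (fun w => G k w ^+ 2 * phi (X k.+1 w) ^+ 2).
    apply: bounded_pastM; first exact: bounded_past_mono bGG.
    exact: bounded_pastX.
  have b2' := bounded_pastM (bounded_past_cst X _ 2) b2.
  have -> : Ex (fun w => stopped_sum c k.+1 w ^+ 2) =
      Ex (fun w => stopped_sum c k w ^+ 2 +
        (2 * (stopped_sum c k w * G k w * phi (X k.+1 w)) +
         G k w ^+ 2 * phi (X k.+1 w) ^+ 2)).
    by apply: eq_Rintegral => w _ /=; rewrite -/(G k w); ring.
  rewrite (ExD b1 (bounded_pastD b2' b3)) (ExD b2' b3) (ExZ _ b2).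
  rewrite (Ex_past_mul1 indX mphi bphi mean0 _ bSG)// mulr0 add0r.
  rewrite (Ex_past_mul2 indX mphi bphi var _ bGG)// -natr1 mulrDl mul1r lerD//.
  rewrite ler_piMr//; apply: (Ex_le_cst bGG) => w.
  rewrite exprn_ile1//; first by apply: prodr_ge0 => j _; rewrite indicE.
  by apply: prodr_ile1 => j _; rewrite indicE; case: (_ \in _); rewrite ler01 lexx.
set A := [set w | _].
have mA : measurable A.
  rewrite (_ : A = \bigcup_(k in [set k | (k <= n)%N]) (psum 1 k @^-1` ~` Y)).
    apply: bigcup_measurable => k _; rewrite -[X in measurable X]setTI.
    apply: measurable_psum => //; exact: measurableC.
  apply/seteqP; split=> [w [k kn ck]|w [k kn ck]]; exists k => //=.
    by apply/negP; rewrite -leNgt.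
  by rewrite leNgt; apply/negP.
rewrite -(@fineK _ (P A)) ?fin_num_measure// lee_fin ler_pdivlMr ?exprn_gt0//.
apply: le_trans (ES n).
have -> : fine (P A) = Ex (\1_A).
  by rewrite /Rintegral -[in LHS](setIT A) -integral_indic.
have iA : P.-integrable setT (EFin \o (\1_A : T -> R)).
  apply: (@bounded_integrable _ _ _ P _ 1); first exact: measurable_indic.
  by move=> w; rewrite indicE; case: (_ \in _); rewrite ?normr1 ?normr0.
rewrite -RintegralZr//; apply: le_Rintegral => //.
- apply: (@bounded_integrable _ _ _ P _ (1 * c ^+ 2)).
    by apply: measurable_funM => //; exact: measurable_indic.
  move=> w; rewrite normrM ger0_norm ?indicE// ler_pM//.
    by case: (_ \in _).
  by rewrite ger0_norm// exprn_ge0// ltW.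
- by apply: (@bounded_past_integrable _ _ _ _ _ _ X n.+1); exact: bounded_pastX.
move=> w _; rewrite -/(\1_A w) indicE.
have [/set_mem [k kn ck]|_] := boolP (w \in A); last by rewrite mul0r sqr_ge0.
rewrite mul1r -[leRHS]real_normK ?num_real// lerXn2r ?nnegrE ?(ltW c0)//.
exact: stopped_sum_ge ck.
Qed.

(** At level [K.+1%:R * Num.sqrt n%:R] the maximal inequality gives [v / K.+1%:R ^+ 2] whatever [n]
    is. This bounds the probability that the maximum is eventually always above the level, and it
    tends to 0 in [K]. *)
Lemma ae_small_sums :
  {ae P, forall w, exists K : nat, forall N, exists2 n, (N <= n)%N &
    forall k, (k <= n)%N -> `|psum 1 k w| < K.+1%:R * Num.sqrt n%:R}.
Proof.
pose A K n := [set w | exists2 k, (k <= n)%N &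
  K.+1%:R * Num.sqrt n%:R <= `|psum 1 k w|].
have mA K n : measurable (A K n).
  rewrite (_ : A K n = \bigcup_(k in [set k | (k <= n)%N])
      (psum 1 k @^-1` [set y | K.+1%:R * Num.sqrt n%:R <= `|y|])).
    apply: bigcup_measurable => k _; rewrite -[X in measurable X]setTI.
    apply: measurable_psum => //.
    rewrite (_ : mkset _ = (fun y : R => `|y|) @^-1` `[K.+1%:R * Num.sqrt n%:R, +oo[).
      rewrite -[X in measurable X]setTI; exact: normr_measurable.
    by apply/seteqP; split=> y; rewrite /= in_itv /= andbT.
  by apply/seteqP; split=> [w [k kn ck]|w [k kn ck]]; exists k.
pose U K := \bigcup_N \bigcap_(n in [set n | (N <= n)%N]) A K n.
have mU K : measurable (U K).
  by apply: bigcup_measurable => N _; apply: bigcap_measurableType => n _.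
have PU K : (P (U K) <= (v / K.+1%:R ^+ 2)%:E)%E.
  apply: measure_liminf_le => // N; exists N.+1 => //.
  have s0 : 0 < Num.sqrt (N.+1%:R : R) by rewrite sqrtr_gt0.
  have := @kolmogorov_maximal (K.+1%:R * Num.sqrt N.+1%:R) N.+1.
  rewrite mulr_gt0// => /(_ isT); rewrite exprMn sqr_sqrtr// => h; apply: le_trans h _.
  rewrite lee_fin le_eqVlt; apply/orP; left; apply/eqP.
  have a0 : (K.+1%:R : R) != 0 by rewrite pnatr_eq0.
  have b0 : (N.+1%:R : R) != 0 by rewrite pnatr_eq0.
  by move: (K.+1%:R) (N.+1%:R) a0 b0 => a b a0 b0; field; rewrite a0 b0.
have P0 : P (\bigcap_K U K) = 0%E.
  have mI : measurable (\bigcap_K U K) by apply: bigcap_measurableType => K _.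
  have le K : fine (P (\bigcap_K U K)) <= v / K.+1%:R ^+ 2.
    rewrite -lee_fin fineK ?fin_num_measure//; apply: le_trans (PU K).
    by rewrite le_measure ?inE//; exact: bigcap_inf.
  rewrite -(@fineK _ (P _)) ?fin_num_measure//; congr (_%:E).
  apply/eqP; rewrite eq_le fine_ge0// andbT leNgt; apply/negP => x0.
  set x := fine _ in le x0.
  (* This [K] satisfies [v < x * K.+1], so the bound falls below [x]. *)
  have := le (Num.truncn (v / x)).
  rewrite ler_pdivlMr ?exprn_gt0//; apply/negP; rewrite -ltNge.
  have h : v / x < (Num.truncn (v / x)).+1%:R by exact: truncnS_gt.
  have h2 : v < x * (Num.truncn (v / x)).+1%:R by rewrite mulrC -ltr_pdivrMr.
  apply: lt_le_trans h2 _; rewrite ler_wpM2l ?(ltW x0)// expr2 ler_peMl//.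
  by rewrite ler1n.
exists (\bigcap_K U K); split => //; first by apply: bigcap_measurableType => K _.
move=> w /= H K _; apply: contrapT => nU; apply: H; exists K => N.
apply: contrapT => H; apply: nU; exists N => // n /= Nn.
apply: contrapT => nA; apply: H; exists n => // k kn.
by rewrite ltNge; apply/negP => hk; apply: nA; exists k.
Qed.

End environment_estimates.

(** * Almost sure behaviour of the walk in a fixed environment *)

Section walk_limits.
Context {d : measure_display} {W : measurableType d} {R : realType}.
Variables (Q : probability W R) (p : nat -> R) (r : nat).
Variable eta : nat -> {RV Q >-> nat}.
Hypothesis walk : quenched_walk p r eta.
Hypothesis p01 : forall n, 0 < p n < 1.
Local Notation V := (potential p).

(** Against a rise [h = c * 2 ^+ k], a time of at most [expR (h / 2)] leaves a crossing probability
    of at most [expR (- h / 2)], hence at most [2 / h], which is summable in [k]. *)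
Lemma walk_upper (c : R) : 0 < c ->
  (\forall k \near \oo, exists2 j, (j < k)%N &
    c * 2 ^+ k <= V (k * 4 ^ k + j * 4 ^ k + 4 ^ k) - V (k * 4 ^ k + j * 4 ^ k)) ->
  {ae Q, forall x, \forall k \near \oo, forall t,
    (t <= Num.truncn (expR (c * 2 ^+ k / 2)))%N -> (eta t x < 3 * k * 4 ^ k)%N}.
Proof.
move=> c0 [k0 _ rise].
(* Shifting by [k1] makes the bounds valid for every index and puts the barrier beyond the starting
   point [r]. *)
pose k1 := maxn k0 (maxn r 1).
pose T k := Num.truncn (expR (c * 2 ^+ k / 2)).
pose A k := ~` stays_below eta (3 * (k + k1) * 4 ^ (k + k1)) (T (k + k1)%N).
have mA k : measurable (A k) by apply: measurableC; exact: measurable_stays_below.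
have QA k : (Q (A k) <= (2 / c * 2^-1 ^+ k)%:E)%E.
  set l := (k + k1)%N.
  have k1l : (k1 <= l)%N by rewrite leq_addl.
  have l1 : (0 < l)%N by move: k1l; rewrite /k1; lia.
  have rl : (r <= l)%N by move: k1l; rewrite /k1; lia.
  have l4 : (l <= l * 4 ^ l)%N by rewrite leq_pmulr// expn_gt0.
  have p4 : (0 < 4 ^ l)%N by rewrite expn_gt0.
  have [j jl cV] : exists2 j, (j < l)%N &
      c * 2 ^+ l <= V (l * 4 ^ l + j * 4 ^ l + 4 ^ l) - V (l * 4 ^ l + j * 4 ^ l).
    by apply: rise => /=; move: k1l; rewrite /k1; lia.
  set a := (l * 4 ^ l + j * 4 ^ l)%N in cV *.
  have al : (l <= a)%N by rewrite /a (leq_trans l4)// leq_addr.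
  (* The successor compensates for [b.-1] in [stays_below_ge], so that the rise ends exactly at
     [a + 4 ^ l]. *)
  have := @stays_below_ge _ _ _ Q p r eta walk p01 a (a + 4 ^ l).+1 (T l).
  rewrite (leq_trans l1 al) ltnS leq_addr (leq_trans rl al) => /(_ isT isT isT) /= h.
  have mB b t : measurable (stays_below eta b t) by exact: measurable_stays_below.
  rewrite probability_setC//.
  rewrite -(@fineK _ (Q (stays_below _ _ _))) ?fin_num_measure// -EFinB lee_fin.
  have sub : fine (Q (stays_below eta (a + 4 ^ l).+1 (T l))) <=
             fine (Q (stays_below eta (3 * l * 4 ^ l) (T l))).
    apply: fine_le; rewrite ?fin_num_measure// le_measure ?inE//.
    move=> x /= H s st; apply: leq_trans (H s st) _.
    by rewrite /a; nia.
  have h2 : (T l)%:R * expR (- (V (a + 4 ^ l) - V a)) <= expR (- (c * 2 ^+ l / 2)).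
    apply: (@le_trans _ _ (expR (c * 2 ^+ l / 2) * expR (- (c * 2 ^+ l)))).
      apply: ler_pM; rewrite ?expR_ge0//.
        by rewrite /T truncn_le// expR_ge0.
      by rewrite ler_expR lerN2.
    by rewrite -expRD ler_expR; lra.
  have c2 : 0 < c * 2 ^+ l / 2 by rewrite divr_gt0// mulr_gt0// exprn_gt0.
  have h3 : expR (- (c * 2 ^+ l / 2)) <= (c * 2 ^+ l / 2)^-1.
    rewrite expRN lef_pV2 ?posrE ?expR_gt0//.
    by apply: le_trans (expR_ge1Dx _); rewrite lerDr.
  have h4 : (c * 2 ^+ l / 2)^-1 <= 2 / c * 2^-1 ^+ k.
    rewrite (_ : (c * 2 ^+ l / 2)^-1 = 2 / c * 2^-1 ^+ l); last first.
      by rewrite exprVn !invfM invrK; ring.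
    rewrite ler_wpM2l ?divr_ge0 ?(ltW c0)// ler_wiXn2l ?leq_addr// ?invr_ge0//.
    by rewrite invf_le1 ?ler1n.
  by lra.
have q01 : 0 <= (2^-1 : R) < 1 by rewrite invr_ge0 ler0n invf_lt1// ltr1n.
have := ae_eventually_not mA q01 QA.
apply: filterS => x [n0 _ H]; exists (n0 + k1)%N => // k /= nk t tk.
have := H (k - k1)%N; rewrite /A /= subnK; last by lia.
by move=> /(_ ltac:(lia)) /contrapT; apply.
Qed.

(** At [s = sqrt n] this gives a multiple of [n ^ 3], enough to beat the factor [n ^ 2] in the
    expected hitting time. *)
Lemma exp_ge_pow6 : exists2 F : R, 0 < F & forall s, 0 <= s -> s ^+ 6 / F <= expR s.
Proof.
exists (6`!%:R); first by rewrite ltr0n fact_gt0.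
by move=> s s0; apply: le_trans (expR_ge1Dxn 5 s0); rewrite lerDr.
Qed.

(** The allotted time exceeds the expected hitting time, of order at most [n^2 * expR (2 M sqrt n)],
    by a factor at least of order [n]. Failure thus becomes arbitrarily unlikely along the good [n],
    and failing at all large [n] is a null event. *)
Lemma walk_lower (M del : R) : 0 < M -> 0 < del -> (forall n, del <= 1 - p n) ->
  (forall N, exists2 n, (N <= n)%N &
    forall k, (k <= n)%N -> `|V k| <= M * Num.sqrt n%:R) ->
  {ae Q, forall x, forall N, exists2 n, (N <= n)%N & exists2 t,
    (t <= Num.truncn (expR ((2 * M + 1) * Num.sqrt n%:R)))%N & (n <= eta t x)%N}.
Proof.
move=> M0 del0 pdel VM.
have [F F0 expF] := exp_ge_pow6.
pose T n := Num.truncn (expR ((2 * M + 1) * Num.sqrt (n%:R : R))).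
pose A n := stays_below eta n (T n).
have mA n : measurable (A n) by exact: measurable_stays_below.
pose U := \bigcup_N \bigcap_(n in [set n | (N <= n)%N]) A n.
have mU : measurable U.
  by apply: bigcup_measurable => N _; apply: bigcap_measurableType => n _.
have QA (e : R) : 0 < e -> forall N, exists2 n, (N <= n)%N & (Q (A n) <= e%:E)%E.
  move=> e0 N.
  (* The estimates below give a failure probability of at most [2 * F / (del * n)], which is at most
     [e] once [n] exceeds [D]. *)
  pose D : R := 2 * F / (del * e).
  have [m Dm] : exists m : nat, D < m%:R by exists (Num.truncn D).+1; exact: truncnS_gt.
  have [n Nn Vn] := VM (maxn N (maxn r m).+1); exists n; first by lia.
  have n0 : (0 < n)%N by lia.
  have Dn : D < n%:R.
    by apply: lt_le_trans Dm _; rewrite ler_nat; lia.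
  rewrite -(@fineK _ (Q (A n))) ?fin_num_measure// lee_fin.
  have := @stays_below_le _ _ _ Q p r eta walk p01 n (T n) (M * Num.sqrt n%:R) del.
  rewrite -/(A n) => /(_ _ del0 pdel); set q := fine _ => h.
  have {}h : (T n)%:R * q <= n%:R ^+ 2 / del * expR (2 * (M * Num.sqrt n%:R)).
    by apply: h => [|k kn]; [lia | apply: Vn; exact: ltnW].
  set s := Num.sqrt (n%:R : R) in h *.
  have s2 : s ^+ 2 = n%:R by rewrite sqr_sqrtr.
  have s0 : 0 < s by rewrite sqrtr_gt0 ltr0n.
  have q0 : 0 <= q by rewrite fine_ge0.
  (* The exponential is at least 1, so truncation costs at most a factor 2. *)
  have hT : expR ((2 * M + 1) * s) <= 2 * (T n)%:R.
    have h1 : expR ((2 * M + 1) * s) < (T n).+1%:R by exact: truncnS_gt.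
    have h2 : (1 <= T n)%N.
      have h20 : 0 <= (2 * M + 1) * s by apply: mulr_ge0; [lra | exact: ltW].
      by rewrite /T -/s truncn_ge_nat ?expR_ge0//; apply: le_trans (expR_ge1Dx _); lra.
    have h3 : 1 <= (T n)%:R :> R by rewrite ler1n.
    by move: h1; rewrite -natr1; lra.
  have e6 : n%:R ^+ 3 / F <= expR s.
    by have := expF s (ltW s0); rewrite (exprM s 2 3) s2.
  have h5 : expR ((2 * M + 1) * s) = expR (2 * (M * s)) * expR s.
    by rewrite -expRD; congr expR; ring.
  set E := expR (2 * (M * s)) in h h5.
  have E0 : 0 < E by exact: expR_gt0.
  have h6 : E * (expR s * q) <= E * (2 * (n%:R ^+ 2 / del)).
    apply: (@le_trans _ _ (2 * (T n)%:R * q)); last by move: h; lra.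
    by rewrite mulrA -h5 ler_wpM2r.
  rewrite (ler_pM2l E0) in h6.
  have n0R : 0 < n%:R :> R by rewrite ltr0n.
  have h7 : n%:R ^+ 2 * (n%:R / F * q) <= n%:R ^+ 2 * (2 / del).
    apply: le_trans (_ : expR s * q <= _); last first.
      by apply: le_trans h6 _; rewrite le_eqVlt; apply/orP; left; apply/eqP; ring.
    apply: le_trans (ler_wpM2r q0 e6); rewrite le_eqVlt; apply/orP; left; apply/eqP; ring.
  rewrite ler_pM2l ?exprn_gt0// in h7.
  have h8 : 2 * F <= n%:R * (del * e).
    by rewrite -ler_pdivrMr ?mulr_gt0//; exact: ltW.
  have h9 : n%:R / F * q * (del * F) <= 2 / del * (del * F).
    by apply: ler_wpM2r h7; rewrite mulr_ge0// ltW.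
  have h10 : n%:R / F * q * (del * F) = n%:R * del * q by field; rewrite gt_eqF.
  have h11 : 2 / del * (del * F) = 2 * F by field; rewrite gt_eqF.
  rewrite h10 h11 in h9.
  rewrite -(ler_pM2l (mulr_gt0 n0R del0)).
  by apply: le_trans h9 (le_trans h8 _); rewrite mulrA.
have Q0 : Q U = 0%E.
  rewrite -(@fineK _ (Q U)) ?fin_num_measure//; congr (_%:E).
  apply/eqP; rewrite eq_le fine_ge0// andbT; apply/ler_addgt0Pl => e e0.
  by rewrite addr0 -lee_fin fineK ?fin_num_measure//; exact: measure_liminf_le (QA e e0).
exists U; split => // x /= H; apply: contrapT => nU; apply: H => N.
apply: contrapT => H; apply: nU; exists N => // n /= Nn s st.
by rewrite ltnNge; apply/negP => ns; apply: H; exists n => //; exists s.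
Qed.

End walk_limits.

(** * From exponential time scales to iterated logarithms *)

Section growth.
Context {R : realType}.
Variable u : nat -> nat.

(** For the least [k] with [t <= T k], [ln t] is of order [2 ^ k] and [k] is at most of order
    [ln (ln t)]. Hence [u t] is at most of order [(ln t)^2 * ln (ln t)], and one more factor
    [ln (ln t)] absorbs the constant. *)
Lemma eventually_lt_loglog (c s : R) : 0 < c -> 2 <= s ->
  (\forall k \near \oo, forall t,
    (t <= Num.truncn (expR (c * 2 ^+ k / 2)))%N -> (u t < 3 * k * 4 ^ k)%N) ->
  \forall t \near \oo, 0 <= (u t)%:R / ln (t%:R : R) ^+ 2 < ln (ln (t%:R : R)) `^ s.
Proof.
move=> c0 s2 [k0 _ H].
(* The other half of [ln 2] absorbs the constant [ln (c / 4)] for large [k]. *)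
pose l2 : R := ln 2 / 2.
have l20 : 0 < l2 by apply: divr_gt0 => //; apply: ln_gt0; lra.
(* Here [48 = 3 * 16]: the 3 of the hypothesis, [16 / c ^+ 2] from comparing [4 ^ k] with [L ^+ 2],
   and [l2^-1] from comparing [k] with [ln L]. *)
pose D : R := 48 / c ^+ 2 / l2.
have D0 : 0 < D by apply: divr_gt0 => //; apply: divr_gt0 => //; exact: exprn_gt0.
have aux (A B C : R) : B + (A + A) <= C -> - A <= B -> A <= C by lra.
have natlt (x : R) : exists m : nat, x < m%:R.
  by exists (Num.truncn x).+1; exact: truncnS_gt.
have [m1 hm1] := natlt (`|ln (c / 4)| / l2).
have [m2 hm2] := natlt ((D + 1) / l2).
pose k1 := maxn k0 (maxn m1 m2).
pose T k := expR (c * 2 ^+ k / 2).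
have Tmono k l : (k <= l)%N -> T k <= T l.
  by move=> kl; rewrite ler_expR ler_pM2r// ler_pM2l// ler_weXn2l// ler1n.
exists (Num.truncn (T k1)).+1 => // t /= tk.
have T0 k : 0 <= T k by exact: expR_ge0.
have tR : T k1 < t%:R by apply: lt_le_trans (truncnS_gt _) _; rewrite ler_nat.
have ex : exists k, (t%:R <= T k).
  exists (Num.truncn (2 * t%:R / c)).+1.
  set m := _.+1.
  have hm : 2 * t%:R / c < m%:R by exact: truncnS_gt.
  apply: (@le_trans _ _ (c * 2 ^+ m / 2)).
    have : m%:R <= 2 ^+ m :> R by rewrite -natrX ler_nat ltnW// ltn_expl.
    move: hm; rewrite ltr_pdivrMr// => h1 h2.
    by have := ler_wpM2l (ltW c0) h2; lra.
  by apply: le_trans (expR_ge1Dx _); rewrite lerDr.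
pose k := ex_minn ex.
have [tTk kmin] : t%:R <= T k /\ forall m, t%:R <= T m -> (k <= m)%N.
  by rewrite /k; case: ex_minnP.
have k1k : (k1 < k)%N.
  by rewrite ltnNge; apply/negP => kk1; move: tR; rewrite ltNge (le_trans tTk)// Tmono.
have [k0k m1k m2k] : [/\ (k0 <= k)%N, (m1 <= k)%N & (m2 <= k)%N].
  by move: (ltnW k1k); rewrite /k1 !geq_max => /and3P[].
have kS : k = k.-1.+1 by rewrite prednK//; exact: leq_ltn_trans k1k.
have Tt : T k.-1 < t%:R.
  by rewrite ltNge; apply/negP => /kmin; rewrite [X in (X <= _)%N]kS ltnn.
have t0 : 0 < t%:R :> R by apply: le_lt_trans Tt.
set L := ln (t%:R : R).
have hL : c * 2 ^+ k / 4 < L.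
  rewrite -ltr_expR lnK ?posrE//; apply: le_lt_trans Tt.
  by rewrite ler_expR [in leLHS]kS exprS; lra.
have c2k : 0 < c * 2 ^+ k by rewrite mulr_gt0// exprn_gt0.
have L0 : 0 < L by apply: lt_trans hL; rewrite divr_gt0.
have hLL : k%:R * l2 <= ln L.
  have h1 : ln (c * 2 ^+ k / 4) <= ln L by rewrite ler_ln ?posrE ?divr_gt0//; exact: ltW.
  have h2 : ln (c * 2 ^+ k / 4) = ln (c / 4) + k%:R * (l2 + l2).
    rewrite (_ : c * 2 ^+ k / 4 = c / 4 * 2 ^+ k); last by ring.
    rewrite lnM ?posrE ?divr_gt0 ?exprn_gt0// lnXn//; congr (_ + _).
    by rewrite -[LHS]mulr_natl; congr (_ * _); rewrite /l2; lra.
  have h3 : `|ln (c / 4)| <= k%:R * l2.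
    rewrite -ler_pdivrMr// ltW//; apply: lt_le_trans hm1 _.
    by rewrite ler_nat.
  by apply: (aux _ (ln (c / 4))); [rewrite -mulrDr -h2 | exact: lerNnormlW].
(* The extra 1 gives [ln L >= 1], so that powers of [ln L] increase with the exponent. *)
have LLD : D + 1 <= ln L.
  apply: le_trans hLL; rewrite -ler_pdivrMr// ltW//; apply: lt_le_trans hm2 _.
  by rewrite ler_nat.
have utk : (u t < 3 * k * 4 ^ k)%N.
  apply: H => /=; first exact: k0k.
  by rewrite truncn_ge_nat ?expR_ge0.
apply/andP; split; first by rewrite divr_ge0// sqr_ge0.
have LL0 : 0 < ln L by lra.
apply: (@lt_le_trans _ _ (D * ln L)).
  rewrite ltr_pdivrMr ?exprn_gt0//.
  apply: (@lt_le_trans _ _ (3 * k%:R * (2 ^+ k) ^+ 2)).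
    rewrite (_ : 3 * _ * _ = (3 * k * 4 ^ k)%:R) ?ltr_nat//.
    by rewrite !natrM natrX -exprM mulnC exprM -[2 ^+ 2]natrX.
  have h4 : (2 ^+ k) ^+ 2 <= 16 / c ^+ 2 * L ^+ 2.
    rewrite mulrAC ler_pdivlMr ?exprn_gt0// -exprMn [16](_ : _ = 4 ^+ 2); last by ring.
    rewrite -exprMn lerXn2r// ?nnegrE ?mulr_ge0 ?exprn_ge0 ?(ltW c0) ?(ltW L0)//.
    by rewrite mulrC; move: hL; lra.
  have h5 : k%:R <= l2^-1 * ln L by rewrite mulrC ler_pdivlMr.
  rewrite (_ : D * ln L * L ^+ 2 = 3 * (l2^-1 * ln L) * (16 / c ^+ 2 * L ^+ 2)); last first.
    by rewrite /D; ring.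
  by apply: ler_pM; rewrite ?mulr_ge0 ?sqr_ge0// ler_wpM2l.
apply: (@le_trans _ _ (ln L `^ 2)).
  by rewrite powR_mulrn ?(ltW LL0)// expr2 ler_wpM2r ?(ltW LL0)//; lra.
by rewrite ler_powR//; lra.
Qed.

(** From [n <= u t] and [ln t <= M * sqrt n] the ratio is at least [M^-2], a constant that
    eventually exceeds the negative power of the triple logarithm. *)
Lemma infinitely_often_gt_loglog (M eps : R) : 0 < M -> 0 < eps ->
  (forall N, exists2 n, (N <= n)%N & exists2 t,
    (t <= Num.truncn (expR (M * Num.sqrt n%:R)))%N & (n <= u t)%N) ->
  infinite_set [set t : nat | ln (ln (ln (t%:R : R))) `^ (- 1 - eps) <
    (u t)%:R / ln (t%:R : R) ^+ 2].
Proof.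
move=> M0 eps0 H.
suff inf t0 : exists2 t, (t0 <= t)%N & ln (ln (ln (t%:R : R))) `^ (- 1 - eps) <
    (u t)%:R / ln (t%:R : R) ^+ 2.
  move=> /finite_seqP[l lE].
  have [t lt ht] := inf (\max_(i <- l) i).+1.
  have : t \in l.
    by move: ht; have : [set` l] t = _ := congr1 (fun A => A t) (esym lE); move=> /= ->.
  move=> /(fun h => @leq_bigmax_seq _ l xpredT id t h isT); lia.
(* Beyond [t1] the triple logarithm is at least [M ^+ 2 + 1]. *)
pose t1 := (Num.truncn (expR (expR (expR (M ^+ 2 + 1))))).+1.
(* An [n] above all values of [u] before [maxn t0 t1] forces [t] past that time. *)
have [n Nn [t tT nu]] := H (\max_(i < maxn t0 t1) u i).+1.
have tt : (maxn t0 t1 <= t)%N.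
  rewrite leqNgt; apply/negP => lt.
  have := leq_trans Nn nu; rewrite ltnNge => /negP; apply.
  exact: (@leq_bigmax _ (fun i : 'I_(maxn t0 t1) => u i) (Ordinal lt)).
exists t; first by lia.
have tR : expR (expR (expR (M ^+ 2 + 1))) <= t%:R.
  by apply: le_trans (ltW (truncnS_gt _)) _; rewrite ler_nat -/t1; lia.
have M1 : 1 <= M ^+ 2 + 1 by rewrite lerDr sqr_ge0.
have t0R : 0 < t%:R :> R by apply: lt_le_trans tR; exact: expR_gt0.
have h1 : expR (expR (M ^+ 2 + 1)) <= ln t%:R by rewrite -ler_expR lnK.
have L0 : 0 < ln (t%:R : R) by apply: lt_le_trans h1; exact: expR_gt0.
have h2 : expR (M ^+ 2 + 1) <= ln (ln t%:R) by rewrite -ler_expR lnK.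
have LL0 : 0 < ln (ln (t%:R : R)) by apply: lt_le_trans h2; exact: expR_gt0.
have h3 : M ^+ 2 + 1 <= ln (ln (ln t%:R)) by rewrite -ler_expR lnK.
set L3 := ln (ln (ln _)) in h3 *.
have M2 : 0 < M ^+ 2 by rewrite exprn_gt0.
apply: (@lt_le_trans _ _ (M ^+ 2)^-1).
  rewrite -opprD powRN ltf_pV2 ?posrE ?powR_gt0//; last by lra.
  apply: (@lt_le_trans _ _ (L3 `^ 1)); first by rewrite powRr1; lra.
  by rewrite ler_powR; lra.
rewrite ler_pdivlMr ?exprn_gt0// ler_pdivrMl//.
have h4 : ln (t%:R : R) <= M * Num.sqrt n%:R.
  rewrite -ler_expR lnK ?posrE//.
  by move: tT; rewrite truncn_ge_nat// expR_ge0.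
apply: (@le_trans _ _ ((M * Num.sqrt n%:R) ^+ 2)).
  by rewrite lerXn2r// nnegrE ?(ltW L0)// mulr_ge0// ltW.
by rewrite exprMn sqr_sqrtr// ler_wpM2l// ?ler_nat// ltW.
Qed.

End growth.

(** * The random environment *)

Section log_odds.
Context {R : realType}.

Lemma ln_lipschitz (m x y : R) : 0 < m -> m <= x -> m <= y ->
  `|ln x - ln y| <= m^-1 * `|x - y|.
Proof.
move=> m0; wlog xy : x y / y <= x => [H mx my|mx my].
  case/orP: (le_total y x) => xy; first exact: H.
  by rewrite [leLHS]distrC [`|x - y|]distrC; exact: H.
have y0 : 0 < y by exact: lt_le_trans my.
have x0 : 0 < x by exact: lt_le_trans mx.
rewrite !ger0_norm ?subr_ge0 ?ler_ln ?posrE// -ln_div ?posrE//.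
have -> : x / y = 1 + (x - y) / y by field; rewrite gt_eqF.
apply: (@le_trans _ _ ((x - y) / y)).
  rewrite -ler_expR lnK ?posrE; first exact: expR_ge1Dx.
  by rewrite ltr_pwDl// divr_ge0 ?subr_ge0// ltW.
by rewrite mulrC ler_wpM2r ?subr_ge0// lef_pV2.
Qed.

Definition log_odds (x : R) : R := ln (x / (1 - x)).

Lemma log_odds_lipschitz (m x y : R) : 0 < m -> m <= x <= 1 - m -> m <= y <= 1 - m ->
  `|log_odds x - log_odds y| <= 2 / m * `|x - y|.
Proof.
move=> m0 /andP[mx xm] /andP[my ym].
have h z : m <= z -> z <= 1 - m -> log_odds z = ln z - ln (1 - z).
  by move=> mz zm; rewrite /log_odds ln_div// posrE; lra.
rewrite !h//.
have h1 := ln_lipschitz m0 mx my.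
have h2 : `|ln (1 - y) - ln (1 - x)| <= m^-1 * `|(1 - y) - (1 - x)|.
  by apply: ln_lipschitz => //; lra.
have e2 : (1 - y) - (1 - x) = x - y by ring.
rewrite e2 in h2.
have -> : ln x - ln (1 - x) - (ln y - ln (1 - y)) =
    (ln x - ln y) + (ln (1 - y) - ln (1 - x)) by ring.
apply: le_trans (ler_normD _ _) _.
by move: h1 h2; move: `|ln x - ln y| `|ln (1 - y) - ln (1 - x)| => A B; lra.
Qed.

Lemma log_odds_bound (m x : R) : 0 < m -> m <= x <= 1 - m -> `|log_odds x| <= m^-1.
Proof.
move=> m0 xm; have m2 : m <= 1 / 2 by lra.
have h : log_odds (1 / 2) = 0 by rewrite /log_odds (_ : 1 / 2 / (1 - 1 / 2) = 1) ?ln1//; field.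
rewrite -[log_odds x]subr0 -h.
apply: le_trans (log_odds_lipschitz m0 xm _) _; first lra.
have : `|x - 1 / 2| <= 1 / 2 by rewrite ler_norml; lra.
have : 0 < m^-1 by rewrite invr_gt0.
by nra.
Qed.

Lemma truncate_itv (a b x : R) : a <= b -> a <= truncate a b x <= b.
Proof. by move=> ab; rewrite /truncate; do 2 case: ltP => ?; apply/andP; split; lra. Qed.

Lemma truncate_id (a b x : R) : a <= x <= b -> truncate a b x = x.
Proof. by move=> /andP[ax xb]; rewrite /truncate !ltNge ax xb. Qed.

Lemma truncate_dist (a b x y : R) : a <= x <= b -> `|truncate a b y - x| <= `|y - x|.
Proof.
move=> /andP[ax xb]; rewrite /truncate; case: ltP => ya.
  by rewrite ler0_norm ?subr_le0// ler0_norm ?subr_le0; lra.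
case: ltP => // yb.
by rewrite ger0_norm ?subr_ge0// ger0_norm ?subr_ge0; lra.
Qed.

Lemma measurable_truncate (a b : R) : measurable_fun setT (truncate a b).
Proof.
apply: measurable_fun_ifT => //; first exact: measurable_fun_ltr.
by apply: measurable_fun_ifT => //; exact: measurable_fun_ltr.
Qed.

(** Outside [(0, 1)] the quotient is nonpositive, division by zero giving 0, and [ln] is 0 there by
    convention; hence the piecewise form. *)
Lemma measurable_log_odds : measurable_fun setT log_odds.
Proof.
pose f (x : R) := if 0 < x then if x < 1 then ln x - ln (1 - x) else 0 else 0.
rewrite (_ : log_odds = f).
  apply: measurable_fun_ifT => //; first exact: measurable_fun_ltr.
  apply: measurable_fun_ifT => //; first exact: measurable_fun_ltr.
  apply: measurable_funB; first exact: measurable_ln.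
  by apply: (measurableT_comp (@measurable_ln R)); exact: measurable_funB.
apply/funext => x; rewrite /f /log_odds; case: ifPn => x0; last first.
  rewrite -leNgt in x0; apply: ln0.
  by rewrite mulr_le0_ge0// invr_ge0; lra.
case: ifPn => x1; first by rewrite ln_div// posrE; lra.
rewrite -leNgt in x1; apply: ln0.
by rewrite mulr_ge0_le0// ?invr_le0; lra.
Qed.

Lemma envp_itv (delta alpha : R) (x y : nat -> R) n : 0 < delta < 1 / 2 ->
  delta / 2 <= envp delta alpha x y n <= 1 - delta / 2.
Proof.
move=> /andP[d0 d1]; rewrite /envp; case: eqP => _; last by apply: truncate_itv; lra.
by apply/andP; split; lra.
Qed.

(** Truncating to an interval that contains [x n] does not increase the distance to it, and for
    [n >= 1] the power [- alpha] is at most the power [- 1 / 2]. *)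
Lemma log_odds_envp (delta alpha : R) (x y : nat -> R) n :
  0 < delta < 1 / 2 -> 1 / 2 <= alpha -> (0 < n)%N ->
  delta <= x n <= 1 - delta -> -1 <= y n <= 1 ->
  `|log_odds (envp delta alpha x y n) - log_odds (x n)| <= 4 / delta * (Num.sqrt n%:R)^-1.
Proof.
move=> d01 a12 n0 xn yn; have /andP[d0 d1] := d01.
have pn := envp_itv alpha x y n d01.
have xn2 : delta / 2 <= x n <= 1 - delta / 2 by lra.
apply: le_trans (log_odds_lipschitz _ pn xn2) _; first lra.
have -> : 2 / (delta / 2) = 4 / delta by field; rewrite gt_eqF.
have d4 : 0 <= 4 / delta by apply: divr_ge0 => //; exact: ltW.
rewrite (ler_wpM2l d4)// /envp (gtn_eqF n0).
apply: le_trans (truncate_dist (x n + y n * n%:R `^ (- alpha)) xn2) _.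
rewrite addrAC subrr add0r normrM.
have nR : 1 <= n%:R :> R by rewrite ler1n.
rewrite (ger0_norm (powR_ge0 _ _)).
apply: (@le_trans _ _ (1 * n%:R `^ (- alpha))).
  by rewrite ler_wpM2r ?powR_ge0// ler_norml.
rewrite mul1r -powR12_sqrt// -powRN ler_powR//; lra.
Qed.

Lemma sum_inv_sqrt (n : nat) : \sum_(1 <= i < n.+1) (Num.sqrt i%:R)^-1 <= 2 * Num.sqrt n%:R :> R.
Proof.
elim: n => [|n IH]; first by rewrite big_geq// sqrtr0 mulr0.
rewrite big_nat_recr//=; apply: le_trans (lerD IH (lexx _)) _.
set a := Num.sqrt n%:R; set b : R := Num.sqrt n.+1%:R.
have a0 : 0 <= a by exact: sqrtr_ge0.
have b0 : 0 < b by rewrite sqrtr_gt0.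
have ab : a <= b by rewrite ler_sqrt// ler_nat.
have a2 : a ^+ 2 = n%:R by rewrite sqr_sqrtr.
have b2 : b ^+ 2 = n%:R + 1 by rewrite sqr_sqrtr// natr1.
have h : b * b^-1 = 1 by rewrite mulfV// gt_eqF.
(* As [b^2 = a^2 + 1], the claim [1 / b <= 2 (b - a)] reduces to [(b - a)^2 >= 0]. *)
rewrite -(ler_pM2r b0) mulrDl mulVf ?gt_eqF//.
by nra.
Qed.

End log_odds.

(** * Comparison of the potential with the unperturbed sums *)

Section environment_potential.
Context {R : realType}.
Variables (delta alpha : R) (x y : nat -> R).
Hypotheses (d01 : 0 < delta < 1 / 2) (a12 : 1 / 2 <= alpha).
Hypothesis xd : forall n, (0 < n)%N -> delta <= x n <= 1 - delta.
Hypothesis y1 : forall n, (0 < n)%N -> -1 <= y n <= 1.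
Local Notation p := (envp delta alpha x y).
Local Notation V := (potential p).
Local Notation S a n := (\sum_(a <= i < a + n) log_odds (x i)).

Lemma potentialB a n : V (a + n) - V a = \sum_(a.+1 <= i < a.+1 + n) log_odds (p i).
Proof.
by rewrite /potential -addSn (@big_cat_nat _ _ _ a.+1)//= ?leq_addr// addrAC subrr add0r.
Qed.

Lemma potential_approx a n :
  `|(V (a + n) - V a) - S a.+1 n| <=
  \sum_(a.+1 <= i < a.+1 + n) 4 / delta * (Num.sqrt i%:R)^-1.
Proof.
rewrite potentialB -sumrB; apply: le_trans (ler_norm_sum _ _ _) _.
apply: ler_sum_nat => i /andP[ai _]; have i0 : (0 < i)%N by exact: leq_ltn_trans ai.
exact: log_odds_envp (xd i0) (y1 i0).
Qed.

Let d0 : 0 < delta. Proof. by case/andP: d01. Qed.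

(** The perturbations add up to at most a multiple of [sqrt n], the order of the sums themselves, so
    only the constant changes. *)
Lemma potential_norm_le n k : (k <= n)%N ->
  `|V k| <= `|S 1 k| + 8 / delta * Num.sqrt n%:R.
Proof.
move=> kn; have := potential_approx 0 k; rewrite potential0 subr0 add0n.
rewrite -mulr_sumr add1n; set s := \sum_(1 <= i < k.+1) log_odds (x i) => h.
have h2 : 4 / delta * (\sum_(1 <= i < k.+1) (Num.sqrt i%:R)^-1) <= 8 / delta * Num.sqrt n%:R.
  have h3 : \sum_(1 <= i < k.+1) (Num.sqrt i%:R)^-1 <= 2 * Num.sqrt n%:R :> R.
    by apply: le_trans (sum_inv_sqrt k) _; rewrite ler_pM2l// ler_sqrt// ler_nat.
  rewrite (_ : 8 / delta * _ = 4 / delta * (2 * Num.sqrt n%:R)); last by ring.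
  by rewrite ler_wpM2l// divr_ge0// ltW.
have := ler_normD (V k - s) s; rewrite subrK; lra.
Qed.

(** Beyond [k * 4 ^ k] each of the [4 ^ k] perturbations is at most [4 / delta] divided by
    [sqrt k * 2 ^ k]. Their total is at most [c / 2 * 2 ^ k] once [sqrt k] reaches [D]. *)
Lemma potential_rise (c : R) : 0 < c -> \forall k \near \oo, forall j,
  c * 2 ^+ k <= S (k * 4 ^ k + 1 + j * 4 ^ k) (4 ^ k) ->
  c / 2 * 2 ^+ k <= V (k * 4 ^ k + j * 4 ^ k + 4 ^ k) - V (k * 4 ^ k + j * 4 ^ k).
Proof.
move=> c0; pose D : R := 8 / (delta * c).
have D0 : 0 < D by apply: divr_gt0 => //; exact: mulr_gt0.
have [k0 hk0] : exists m : nat, D ^+ 2 < m%:R by exists (Num.truncn (D ^+ 2)).+1; exact: truncnS_gt.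
exists k0 => // k /= kk j.
rewrite (_ : k * 4 ^ k + 1 + j * 4 ^ k = (k * 4 ^ k + j * 4 ^ k).+1)%N; last by lia.
set a := (k * 4 ^ k + j * 4 ^ k)%N => h.
have := potential_approx a (4 ^ k); rewrite ler_norml => /andP[h1 _].
pose s : R := Num.sqrt k%:R.
have Ds : D <= s.
  rewrite -(ger0_norm (ltW D0)) -sqrtr_sqr ler_sqrt//.
  by apply: le_trans (ltW hk0) _; rewrite ler_nat.
have s0 : 0 < s by exact: lt_le_trans Ds.
have P0 : 0 < 2 ^+ k :> R by rewrite exprn_gt0.
have hs i : (a.+1 <= i)%N -> (Num.sqrt (i%:R : R))^-1 <= (s * 2 ^+ k)^-1.
  move=> ai; rewrite lef_pV2 ?posrE ?mulr_gt0// ?sqrtr_gt0 ?ltr0n; last exact: leq_ltn_trans ai.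
  rewrite (_ : 2 ^+ k = Num.sqrt ((2 ^+ k) ^+ 2)); last by rewrite sqrtr_sqr ger0_norm// ltW.
  rewrite -sqrtrM// ler_sqrt// (_ : k%:R * _ = (k * 4 ^ k)%:R).
    by rewrite ler_nat; apply: leq_trans (ltnW ai); rewrite leq_addr.
  by rewrite natrM natrX -exprM mulnC exprM -[2 ^+ 2]natrX.
have h2 : \sum_(a.+1 <= i < a.+1 + 4 ^ k) 4 / delta * (Num.sqrt i%:R)^-1 <=
          c / 2 * 2 ^+ k.
  apply: (@le_trans _ _ (\sum_(a.+1 <= i < a.+1 + 4 ^ k) 4 / delta * (s * 2 ^+ k)^-1)).
    apply: ler_sum_nat => i /andP[ai _]; apply: ler_wpM2l; last exact: hs.
    by apply: divr_ge0 => //; exact: ltW.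
  rewrite sumr_const_nat addKn -[leLHS]mulr_natl.
  rewrite (_ : (4 ^ k)%:R = 2 ^+ k * 2 ^+ k :> R); last first.
    by rewrite natrX -exprMn -natrM.
  rewrite (_ : _ * _ = 4 / delta / s * 2 ^+ k); last first.
    by field; rewrite !gt_eqF.
  rewrite ler_pM2r// ler_pdivrMr//.
  apply: le_trans (_ : c / 2 * D <= _); last by rewrite ler_pM2l// divr_gt0.
  by rewrite le_eqVlt; apply/orP; left; apply/eqP; rewrite /D; field; rewrite !gt_eqF.
by lra.
Qed.

End environment_potential.

Section almost_everywhere_transfer.
Context {d : measure_display} {T : measurableType d} {R : realType}.
Variable P : probability T R.

Lemma ae_prob1 (A : set T) : measurable A -> P A = 1%E -> {ae P, forall w, A w}.
Proof.
move=> mA PA; exists (~` A); split => //; first exact: measurableC.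
by rewrite probability_setC// PA subee.
Qed.

Lemma ae_eq_expectation (f g : T -> R) : measurable_fun setT f -> measurable_fun setT g ->
  {ae P, forall w, f w = g w} -> 'E_P[f]%E = 'E_P[g]%E.
Proof.
move=> mf mg fg; rewrite unlock; apply: ae_eq_integral => //.
- exact/measurable_EFinP.
- exact/measurable_EFinP.
- by apply: filterS fg => w -> _.
Qed.

Lemma ae_cst_variance0 (f : T -> R) (c : R) : measurable_fun setT f ->
  {ae P, forall w, f w = c} -> 'V_P[f]%E = 0%E.
Proof.
move=> mf fc; have mc : measurable_fun setT (cst c : T -> R) by exact: measurable_cst.
rewrite /variance random_variable.covariance.unlock.
rewrite (ae_eq_expectation mf mc fc) expectation_cst /=.
rewrite (@ae_eq_expectation _ (cst 0)); first exact: expectation_cst.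
- apply: measurable_funM; exact: measurable_funB.
- exact: measurable_cst.
- by apply: filterS fc => w fw; rewrite [LHS](_ : _ = (f w - c) * (f w - c))// fw subrr mul0r.
Qed.

End almost_everywhere_transfer.

Section iid_transfer.
Context {d : measure_display} {T : measurableType d} {R : realType}.
Context {d' : measure_display} {T' : measurableType d'}.
Variables (P : probability T R) (X : nat -> {RV P >-> T'}) (D : set nat).
Hypothesis distX : identically_distributed D X.

Lemma identically_distributed_ae (A : set T') i j : D i -> D j -> measurable A ->
  P (X i @^-1` A) = 1%E -> {ae P, forall w, A (X j w)}.
Proof.
move=> Di Dj mA PA; apply: ae_prob1; first exact: measurable_funPTI.
by transitivity (distribution P (X i) A); [symmetry; exact: distX | exact: PA].
Qed.

Lemma identically_distributed_Rintegral (f : T' -> R) (M : R) i j : D i -> D j ->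
  measurable_fun setT f -> (forall y, `|f y| <= M) ->
  \int[P]_w f (X i w) = \int[P]_w f (X j w).
Proof.
move=> Di Dj mf fM.
have E k : (\int[P]_w (f (X k w))%:E = \int[distribution P (X k)]_y (f y)%:E)%E.
  rewrite integral_distribution//; first exact/measurable_EFinP.
  apply: (@bounded_integrable _ _ _ P (fun w => f (X k w)) M) => //.
  exact: (measurableT_comp mf).
rewrite /Rintegral !E; congr fine.
by apply: eq_measure_integral => A mA _; exact: distX.
Qed.

End iid_transfer.

(** * Both bounds for almost every environment *)

Section quenched_limits.
Context {R : realType} {d : measure_display} {Omega : measurableType d}.
Variables (P : probability Omega R) (delta alpha : R).
Variable xiY : nat -> {RV P >-> (R * R)%type}.
Context {d' : measure_display} {W : measurableType d'}.
Variables (Pq : Omega -> probability W R) (r : nat).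
Variable eta : forall w : Omega, nat -> {RV (Pq w) >-> nat}.
Local Notation xi n w := (xiY n w).1.
Local Notation Y n w := (xiY n w).2.
Local Notation p w := (envp delta alpha (fun n => xi n w) (fun n => Y n w)).
Hypothesis d01 : 0 < delta < 1 / 2.
Hypothesis iidX : iid [set n | (0 < n)%N] xiY.
Hypothesis xi_itv : P [set w | delta <= xi 1%N w <= 1 - delta] = 1%E.
Hypothesis Y_itv : P [set w | -1 <= Y 1%N w <= 1] = 1%E.
Hypothesis walk : forall w, quenched_walk (p w) r (eta w).
Hypothesis Ezeta : 'E_P[fun w => ln (xi 1%N w / (1 - xi 1%N w))]%E = 0%E.
Hypothesis Vxi : (0 < 'V_P[fun w => xi 1%N w])%E.
Hypothesis a12 : 1 / 2 <= alpha.

(* Truncating makes the log-odds bounded everywhere; a.s. nothing changes. *)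
Let phi (z : R * R) : R := log_odds (truncate delta (1 - delta) z.1).

Let d0 : 0 < delta. Proof. by case/andP: d01. Qed.

Let mphi : measurable_fun setT phi.
Proof.
apply: (measurableT_comp measurable_log_odds).
apply: (measurableT_comp (measurable_truncate delta (1 - delta))).
exact: measurable_fst.
Qed.

Let bphi z : `|phi z| <= delta^-1.
Proof.
by apply: log_odds_bound => //; apply: truncate_itv; case/andP: d01; lra.
Qed.

Lemma ae_environment : {ae P, forall w, forall n, (0 < n)%N ->
  delta <= xi n w <= 1 - delta /\ -1 <= Y n w <= 1}.
Proof.
have [_ distX] := iidX.
apply: ae_foralln => -[|n]; first exact: aeW.
have m1 : measurable [set z : R * R | delta <= z.1 <= 1 - delta].
  rewrite (_ : mkset _ = fst @^-1` `[delta, 1 - delta]%classic).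
    by rewrite -[X in measurable X]setTI; exact: measurable_fst.
  by apply/seteqP; split => z; rewrite /= in_itv.
have m2 : measurable [set z : R * R | -1 <= z.2 <= 1].
  rewrite (_ : mkset _ = snd @^-1` `[-1, 1]%classic).
    by rewrite -[X in measurable X]setTI; exact: measurable_snd.
  by apply/seteqP; split => z; rewrite /= in_itv.
have h1 := identically_distributed_ae distX (ltn0Sn 0) (ltn0Sn n) m1 xi_itv.
have h2 := identically_distributed_ae distX (ltn0Sn 0) (ltn0Sn n) m2 Y_itv.
by apply: filterS2 h1 h2 => w /= ? ? _.
Qed.

Let phiE w n : delta <= xi n w <= 1 - delta -> phi (xiY n w) = log_odds (xi n w).
Proof. by move=> h; rewrite /phi truncate_id. Qed.

Let mxi : measurable_fun setT (fun w => xi 1%N w).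
Proof. exact: (measurableT_comp measurable_fst). Qed.

Let mean0 k : (0 < k)%N -> \int[P]_w phi (xiY k w) = 0.
Proof.
move=> k0; have [_ distX] := iidX.
rewrite (identically_distributed_Rintegral distX k0 (ltn0Sn 0) mphi bphi).
rewrite /Rintegral; suff -> : (\int[P]_w (phi (xiY 1%N w))%:E = 0)%E by [].
have := Ezeta; rewrite (@ae_eq_expectation _ _ _ P _ (fun w => phi (xiY 1%N w))).
- by rewrite unlock.
- exact: (measurableT_comp measurable_log_odds).
- exact: (measurableT_comp mphi).
- by apply: filterS ae_environment => w /(_ 1%N isT)[h _]; rewrite phiE.
Qed.

Let v := \int[P]_w phi (xiY 1%N w) ^+ 2.

Let var k : (0 < k)%N -> \int[P]_w phi (xiY k w) ^+ 2 = v.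
Proof.
move=> k0; have [_ distX] := iidX.
apply: (@identically_distributed_Rintegral _ _ _ _ _ _ _ _ distX
  (fun z => phi z ^+ 2) (delta^-1 ^+ 2) k 1 k0 (ltn0Sn 0)).
  exact: measurable_funX.
by move=> z; rewrite normrX lerXn2r// ?nnegrE// invr_ge0 ltW.
Qed.

(** If [v] were 0, the log-odds of [xi 1] would vanish almost surely, so [xi 1] would be [1 / 2]
    almost surely, against its positive variance. *)
Let v_gt0 : 0 < v.
Proof.
have v0 : 0 <= v by apply: Rintegral_ge0 => w _; rewrite sqr_ge0.
rewrite lt_neqAle v0 andbT; apply/negP => /eqP v_eq0.
have mphi1 : measurable_fun setT (fun w => phi (xiY 1%N w) ^+ 2).
  by apply: measurable_funX; exact: (measurableT_comp mphi).
have intphi : P.-integrable setT (EFin \o (fun w => phi (xiY 1%N w) ^+ 2)).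
  apply: (@bounded_integrable _ _ _ P _ (delta^-1 ^+ 2)) => // w.
  by rewrite normrX lerXn2r// ?nnegrE// invr_ge0 ltW.
have I0 : (\int[P]_w `|(phi (xiY 1%N w) ^+ 2)%:E| = 0)%E.
  under eq_integral do rewrite abse_EFin ger0_norm ?sqr_ge0//.
  by rewrite -[LHS]fineK ?integrable_fin_num// -[fine _]/v -v_eq0.
have /ae_eq_integral_abs := I0; move=> /(_ measurableT (proj2 (measurable_EFinP _ _) mphi1)) ae0.
have : 'V_P[fun w => xi 1%N w]%E = 0%E.
  apply: (@ae_cst_variance0 _ _ _ P _ (1 / 2)) => //.
  apply: filterS2 ae0 ae_environment => w /(_ I) [] /eqP.
  rewrite sqrf_eq0 => /eqP phi0 /(_ 1%N isT)[h _].
  rewrite phiE// /log_odds in phi0.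
  have /andP[h1 h2] := h; have dpos := d0.
  have x1 : 0 < 1 - xi 1%N w by lra.
  have /eqP := phi0; rewrite ln_eq0; last by apply: divr_gt0 => //; lra.
  rewrite -subr_eq0 => /eqP/(congr1 ( *%R^~ (1 - xi 1%N w))).
  by rewrite mulrBl divfK ?gt_eqF// mul0r; lra.
by move=> V0; have := Vxi; rewrite V0 ltxx.
Qed.

Let psumE w a n : (0 < a)%N ->
  (forall n, (0 < n)%N -> delta <= xi n w <= 1 - delta /\ -1 <= Y n w <= 1) ->
  psum xiY phi a n w = \sum_(a <= i < a + n) log_odds (xi i w).
Proof.
move=> a0 h; apply: eq_big_nat => i /andP[ai _].
by rewrite phiE//; have [] := h i (leq_trans a0 ai).
Qed.

Let p01 w n : 0 < p w n < 1.
Proof.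
have /andP[? ?] := envp_itv alpha (fun n => xi n w) (fun n => Y n w) n d01.
by move: d0 => ?; apply/andP; split; lra.
Qed.

(** The exponent [s] is quantified after the environment: the exceptional set of environments comes
    from the rises alone and serves every [s]. *)
Lemma quenched_upper :
  {ae P, forall w, forall s : R, 2 <= s -> {ae Pq w, forall x, \forall t \near \oo,
    0 <= (eta w t x)%:R / ln (t%:R : R) ^+ 2 < ln (ln (t%:R : R)) `^ s}}.
Proof.
have [indX _] := iidX.
have [c c0 rise] := ae_rise indX mphi bphi mean0 var v_gt0.
apply: filterS2 ae_environment rise => w env {}rise s s2.
have xd n (n0 : (0 < n)%N) := (env n n0).1.
have y1 n (n0 : (0 < n)%N) := (env n n0).2.
have c20 : 0 < c / 2 by exact: divr_gt0.
have riseV : \forall k \near \oo, exists2 j, (j < k)%N &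
    c / 2 * 2 ^+ k <= potential (p w) (k * 4 ^ k + j * 4 ^ k + 4 ^ k) -
                      potential (p w) (k * 4 ^ k + j * 4 ^ k).
  apply: filterS2 rise (potential_rise d01 a12 xd y1 c0) => k [j jk cS] H.
  by exists j => //; apply: H; rewrite -psumE// addn1.
have := walk_upper (walk w) (p01 w) c20 riseV.
by apply: filterS => x /(eventually_lt_loglog c20 s2).
Qed.

(** The perturbation only enlarges the random constant [K.+1] by [8 / delta], so the scales provided
    by [ae_small_sums] serve for the potential too. *)
Lemma quenched_lower : {ae P, forall w, forall eps : R, 0 < eps ->
  {ae Pq w, forall x, infinite_set [set t : nat |
    ln (ln (ln (t%:R : R))) `^ (- 1 - eps) < (eta w t x)%:R / ln (t%:R : R) ^+ 2]}}.
Proof.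
have [indX _] := iidX.
apply: filterS2 ae_environment (ae_small_sums indX mphi bphi mean0 var) => w env [K small] eps eps0.
have xd n (n0 : (0 < n)%N) := (env n n0).1.
have y1 n (n0 : (0 < n)%N) := (env n n0).2.
pose M : R := K.+1%:R + 8 / delta.
have M0 : 0 < M by apply: addr_gt0 => //; exact: divr_gt0.
have VM N : exists2 n, (N <= n)%N & forall k, (k <= n)%N ->
    `|potential (p w) k| <= M * Num.sqrt n%:R.
  have [n Nn h] := small N; exists n => // k kn.
  apply: le_trans (potential_norm_le d01 a12 xd y1 kn) _.
  by rewrite /M [leRHS]mulrDl lerD2r -psumE// ltW// h.
have pd n : delta / 2 <= 1 - p w n.
  have /andP[_ ?] := envp_itv alpha (fun n => xi n w) (fun n => Y n w) n d01.
  lra.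
have d20 : 0 < delta / 2 by exact: divr_gt0.
have := walk_lower (walk w) (p01 w) M0 d20 pd VM.
by apply: filterS => x; apply: infinitely_often_gt_loglog => //; lra.
Qed.

End quenched_limits.

Theorem theorem2 (R : realType)
    (d : measure_display) (Omega : measurableType d) (P : probability Omega R)
    (delta alpha : R) (xiY : nat -> {RV P >-> (R * R)%type})
    (d' : measure_display) (W : measurableType d')
    (Pq : Omega -> probability W R) (r : nat)
    (eta : forall w : Omega, nat -> {RV (Pq w) >-> nat}) :
  let xi n w := (xiY n w).1 in
  let Y n w := (xiY n w).2 in
  let zeta n w := ln (xi n w / (1 - xi n w)) in
  let Z n w := Y n w / (xi n w * (1 - xi n w)) in
  let lambda := 'E_P[Z 1%N]%E in
  let s2 := 'V_P[xi 1%N]%E in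
  let sigma2 := 'V_P[Y 1%N]%E in
  let p w := envp delta alpha (xi ^~ w) (Y ^~ w) in
  0 < delta < 1 / 2 -> 0 < alpha ->
  iid [set n | (0 < n)%N] xiY ->
  P [set w | delta <= xi 1%N w <= 1 - delta] = 1%E ->
  P [set w | -1 <= Y 1%N w <= 1] = 1%E ->
  (forall w, quenched_walk (p w) r (eta w)) ->
  'E_P[zeta 1%N]%E = 0%E ->
  (0 < s2 < +oo)%E ->
  lambda != 0%E ->
  (0 <= sigma2 < +oo)%E ->
  [/\ (1 / 2 < alpha ->
        {ae P, forall w, forall eps : R, 0 < eps ->
          {ae Pq w, forall x, \forall t \near \oo,
            0 <= (eta w t x)%:R / ln (t%:R : R) ^+ 2
              < ln (ln (t%:R : R)) `^ (2 + eps)}}),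
      (alpha = 1 / 2 ->
        {ae P, forall w, forall eps : R, 0 < eps ->
          {ae Pq w, forall x, \forall t \near \oo,
            0 <= (eta w t x)%:R / ln (t%:R : R) ^+ 2
              < ln (ln (t%:R : R)) `^ (4 + eps)}})
    & (1 / 2 <= alpha ->
        {ae P, forall w, forall eps : R, 0 < eps ->
          {ae Pq w, forall x, infinite_set [set t : nat |
            ln (ln (ln (t%:R : R))) `^ (- 1 - eps)
              < (eta w t x)%:R / ln (t%:R : R) ^+ 2]}})].
Proof.
move=> xi Y zeta Z lambda s2 sigma2 p d01 _ iidX xiP YP walk Ez /andP[Vxi _] _ _.
(* Parts (i) and (ii) are the instances [s = 2] and [s = 4]. *)
have upper (s : R) : 2 <= s -> 1 / 2 <= alpha ->
  {ae P, forall w, forall eps : R, 0 < eps ->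
    {ae Pq w, forall x, \forall t \near \oo,
      0 <= (eta w t x)%:R / ln (t%:R : R) ^+ 2 < ln (ln (t%:R : R)) `^ (s + eps)}}.
  move=> ? a12; apply: filterS (quenched_upper d01 iidX xiP YP walk Ez Vxi a12) => w H eps ?.
  by apply: H; lra.
split=> [a12|a12|a12].
- by apply: upper => //; exact: ltW.
- by apply: upper; rewrite ?a12//; lra.
- exact: (quenched_lower d01 iidX xiP YP walk Ez a12).
Qed.
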